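(* The following expressions of the $t$-dependent biorthogonal matrix polynomials and second kind functions in terms of the $\tau$-ratio matrices and Miwa shifts hold. For $|z|>r_x$, $$P^{[1],t}_n(z)=z^{-n}\,\tau^{(1)}_{n-1}(t-[z]_1,t),\qquad \big(C^{[2],t}_n(z)\big)^\top(H^t_n)^{-1}=z^{n-1}\big(\tau^{(1)}_n(t,t+[z]_1)\big)^{-1},$$ and for $|z|>r_y$, $$(H^t_n)^{-1}C^{[1],t}_n(z)=z^{n+1}\,\tau^{(2)}_n(t,t-[z]_2),\qquad \big(P^{[2],t}_n(z)\big)^\top=z^{-n}\big(\tau^{(2)}_{n-1}(t+[z]_2,t)\big)^{-1}.$$
   Context: Notation. $p\ge1$ is fixed; $I_p$ is the $p\times p$ identity; $n\in\{0,1,2,\dots\}$. Semi-infinite matrices are written in $p\times p$ blocks indexed by $0,1,2,\dots$; $A_{[n]}$ is the truncation to the first $n$ block rows and columns. $\chi(x)=[I_p,I_px,I_px^2,\dots]^\top$. Generalized kernels. $u=u_{x,y}$ is a $p\times p$ matrix of fast decreasing distributions in the real variables $(x,y)$ (distributions $w$ such that $(1+x^2+y^2)^{k/2}w$ is a bounded distribution for all $k$). With $\operatorname{supp}_x(u),\operatorname{supp}_y(u)$ the projections of its support, $r_x=\sup\{|z|:z\in\operatorname{supp}_x(u)\}$ and $r_y=\sup\{|z|:z\in\operatorname{supp}_y(u)\}$ are assumed finite. Sesquilinear form: $\big(\langle P(x),Q(y)\rangle_u\big)_{i,j}=\sum_{k,l}\langle (u_{x,y})_{k,l},P_{i,k}(x)Q_{j,l}(y)\rangle$,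 for matrix functions smooth near the support. Flows. $t=(t_1,t_2)$, $t_i=(t_{i,1},t_{i,2},\dots)$ with finitely many nonzero entries; $t_1(x)=\sum_jt_{1,j}x^j$, $t_2(y)=\sum_jt_{2,j}y^j$; $u^t_{x,y}=e^{t_1(x)-t_2(y)}u_{x,y}$. The Gram matrix $G^t$ has blocks $\langle I_px^k,I_py^l\rangle_{u^t}$. All the kernels $u^t$ considered (including the Miwa shifted ones) are assumed quasidefinite, i.e. $\det G^t_{[k]}\neq0$ for all $k\ge1$, so that $G^t=(S^t_1)^{-1}H^t(S^t_2)^{-\top}$ with $S_1^t,S_2^t$ lower unitriangular by blocks and $H^t=\operatorname{diag}(H^t_0,H^t_1,\dots)$. $P^{[i],t}(x)=S^t_i\chi(x)$ has blocks $P^{[i],t}_n(x)$. $C^{[1],t}_n(z)=\langle P^{[1],t}_n(x),\frac{I_p}{z-y}\rangle_{u^t}$ for $z\notin\operatorname{supp}_y(u)$, $\big(C^{[2],t}_n(z)\big)^\top=\langle\frac{I_p}{z-x},P^{[2],t}_n(y)\rangle_{u^t}$ for $z\notin\operatorname{supp}_x(u)$. Miwa shifts. $[z]=\big(\frac1z,\frac1{2z^2},\frac1{3z^3},\dots\big)$; $t\pm[z]_1=(t_1\pm[z],t_2)$, $t\pm[z]_2=(t_1,t_2\pm[z])$. Since $\sum_j\frac{x^j}{jz^j}=-\log(1-x/z)$ for $|x|<|z|$, the shifted kernels are $u^{t-[z]_1}=(1-\frac xz)u^t$, $u^{t+[z]_1}=(1-\frac xz)^{-1}u^t$ (for $|z|>r_x$),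 $u^{t-[z]_2}=(1-\frac yz)^{-1}u^t$, $u^{t+[z]_2}=(1-\frac yz)u^t$ (for $|z|>r_y$). $\tau$-ratio matrices: $\tau^{(1)}_n(t,s)=A_nA_{n-1}\cdots A_0$ with $A_m=H^t_m(H^s_m)^{-1}$, and $\tau^{(2)}_n(t,s)=B_nB_{n-1}\cdots B_0$ with $B_m=(H^t_m)^{-1}H^s_m$; an empty product ($\tau^{(i)}_{-1}$) is $I_p$.
   Formalization: The printed powers of z are false and are corrected: z^n (not z^{-n}) in the formulas for P^{[1]}_n and P^{[2]}_n, and z^{-(n+1)} in those for C^{[2]}_n (printed z^{n-1}) and C^{[1]}_n (printed z^{n+1}). *)

(* Defs.v *)
From HB Require Import structures.
From mathcomp Require Import all_boot all_order all_algebra.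
From mathcomp Require Import all_classical all_reals all_analysis.
From mathcomp Require Import complex.

Set Implicit Arguments.
Unset Strict Implicit.
Unset Printing Implicit Defensive.

Import Order.TTheory GRing.Theory Num.Theory.
Import numFieldNormedType.Exports.
Import ComplexField.Normc.

Local Open Scope classical_set_scope.
Local Open Scope complex_scope.
Local Open Scope ring_scope.

(** * Distributions on the plane *)

Section Distributions.
Variable R : realType.
Local Notation C := R[i].
Local Notation plane := (R * R)%type.
Implicit Types (g : plane -> R) (f phi : plane -> C) (q : plane).

Definition dx g : plane -> R := fun q => 'D_((1, 0) : plane) g q.
Definition dy g : plane -> R := fun q => 'D_((0, 1) : plane) g q.

Fixpoint Cn (n : nat) g : Prop :=
  continuous g /\
  if n is m.+1 then
    [/\ forall q, derivable g q ((1, 0) : plane),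
        forall q, derivable g q ((0, 1) : plane),
        Cn m (dx g) & Cn m (dy g)]
  else True.

(* R[i] carries no topology in the libraries, hence the real and imaginary
   parts here and below. *)
Definition smooth f : Prop :=
  forall n, Cn n (fun q => complex.Re (f q)) /\ Cn n (fun q => complex.Im (f q)).

Definition partial (i j : nat) f : plane -> C := fun q =>
  iter i dx (iter j dy (fun q' => complex.Re (f q'))) q
    +i* iter i dx (iter j dy (fun q' => complex.Im (f q'))) q.

Definition fsupp f : set plane := closure [set q | f q != 0].

Definition test_function phi : Prop := smooth phi /\ compact (fsupp phi).

(* A distribution is represented by a functional on all functions; only its
   values at test functions are meaningful. *)
Definition functional : Type := (plane -> C) -> C.

Definition distribution (T : functional) : Prop :=
  (forall (a : C) phi psi, test_function phi -> test_function psi ->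
     T (fun q => a * phi q + psi q) = a * T phi + T psi) /\
  (forall K : set plane, compact K ->
     exists (c : R) (N : nat), forall phi, test_function phi ->
       fsupp phi `<=` K ->
       forall B : R,
         (forall i j q, (i + j <= N)%N -> normc (partial i j phi q) <= B) ->
         normc (T phi) <= c * B).

(* Boundedness in the sense of L. Schwartz: T extends to a continuous
   functional on the space of smooth functions all of whose derivatives are
   integrable, in which the test functions are dense. *)
Definition bounded_distribution (T : functional) : Prop :=
  distribution T /\
  exists (c : R) (N : nat), forall phi, test_function phi ->
    ((normc (T phi))%:E <=
     c%:E * \sum_(ij <- [seq (i, j) | i <- iota 0 N.+1, j <- iota 0 N.+1]
                   | (ij.1 + ij.2 <= N)%N)
        \int[(@lebesgue_measure R \x @lebesgue_measure R)%E]_q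
           (normc (partial ij.1 ij.2 phi q))%:E)%E.

Definition mul_distr (h : plane -> C) (T : functional) : functional :=
  fun phi => T (fun q => h q * phi q).

Definition fast_decreasing (T : functional) : Prop :=
  distribution T /\
  forall k : nat, bounded_distribution
    (mul_distr (fun q => (Num.sqrt (1 + q.1 ^+ 2 + q.2 ^+ 2) ^+ k)%:C) T).

Definition dsupp (T : functional) : set plane :=
  [set q | forall U : set plane, open U -> U q ->
     exists phi, [/\ test_function phi, fsupp phi `<=` U & T phi <> 0]].

(* Pairing of a compactly supported distribution with a function which is
   smooth near its support: f may be replaced by any test function that
   coincides with it near the support, and the value does not depend on the
   choice. *)
Definition pairing (T : functional) f : C :=
  xget 0 [set T phi | phi in [set phi | test_function phi /\
    forall q, dsupp T q -> \forall q' \near q, phi q' = f q']].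

End Distributions.

(** * Matrix kernels, flows and the sesquilinear form *)

Section Kernels.
Variables (R : realType) (p : nat).
Local Notation C := R[i].
Local Notation plane := (R * R)%type.
Local Notation M := 'M[C]_p.

Definition mkernel : Type := 'I_p -> 'I_p -> functional R.

Definition ksupp (u : mkernel) : set plane :=
  [set q | exists k l, dsupp (u k l) q].
Definition suppx (u : mkernel) : set R := [set q.1 | q in ksupp u].
Definition suppy (u : mkernel) : set R := [set q.2 | q in ksupp u].
Definition rx (u : mkernel) : R := sup [set `|x| | x in suppx u].
Definition ry (u : mkernel) : R := sup [set `|y| | y in suppy u].

(* s.1 j and s.2 j are the times s_{1,j} and s_{2,j} for j >= 1; the entries
   of index 0 are never used.  Infinitely many nonzero entries are allowed, so
   that Miwa shifts are ordinary additions of sequences. *)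
Definition times : Type := ((nat -> C) * (nat -> C))%type.

Definition finite_times (t : times) : Prop :=
  exists N : nat, forall j : nat, (N <= j)%N -> t.1 j = 0 /\ t.2 j = 0.

Definition miwa (z : C) : nat -> C := fun j => (j%:R * z ^+ j)^-1.

Definition addmiwa1 (t : times) (z : C) : times :=
  (fun j => t.1 j + miwa z j, t.2).
Definition submiwa1 (t : times) (z : C) : times :=
  (fun j => t.1 j - miwa z j, t.2).
Definition addmiwa2 (t : times) (z : C) : times :=
  (t.1, fun j => t.2 j + miwa z j).
Definition submiwa2 (t : times) (z : C) : times :=
  (t.1, fun j => t.2 j - miwa z j).

(* \sum_(j >= 1) a_j x^j *)
Definition tseries (a : nat -> C) (x : C) : C :=
  limn (fun n => complex.Re (\sum_(1 <= j < n) a j * x ^+ j))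
    +i* limn (fun n => complex.Im (\sum_(1 <= j < n) a j * x ^+ j)).

Definition cexp (w : C) : C :=
  (expR (complex.Re w))%:C * (cos (complex.Im w) +i* sin (complex.Im w)).

Definition evolution (s : times) : plane -> C :=
  fun q => cexp (tseries s.1 q.1%:C - tseries s.2 q.2%:C).

(* The kernel u^s = e^{s_1(x) - s_2(y)} u, as a functional on the functions
   that are smooth near the support of u.  The exponential factor is only
   required to make sense there, which is the case for Miwa shifted times. *)
Definition evolved (u : mkernel) (s : times) : mkernel :=
  fun k l f => pairing (u k l) (fun q => evolution s q * f q).

(* The form <P(x), Q(y)>_v, for v acting on functions smooth near the
   support. *)
Definition form (v : mkernel) (P Q : R -> M) : M :=
  \matrix_(i, j) \sum_k \sum_l v k l (fun q => P q.1 i k * Q q.2 j l).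

Definition blockmx : Type := nat -> nat -> M.

Definition gram (u : mkernel) (s : times) : blockmx := fun k l =>
  form (evolved u s) (fun x => (x%:C ^+ k)%:M) (fun y => (y%:C ^+ l)%:M).

Definition truncation (G : blockmx) (k : nat) :=
  \mxblock_(i < k, j < k) G i j.

Definition quasidefinite (G : blockmx) : Prop :=
  forall k : nat, (0 < k)%N -> \det (truncation G k) != 0.

(** * Gauss-Borel factorization *)

(* Product of semi-infinite block matrices whose left factor is lower
   triangular. *)
Definition bmul (A B : blockmx) : blockmx :=
  fun k l => \sum_(j < k.+1) A k j *m B j l.
Definition bdiag (H : nat -> M) : blockmx :=
  fun k l => if k == l then H k else 0.
Definition btr (A : blockmx) : blockmx := fun k l => (A l k)^T.

Definition lower_unitriangular (S : blockmx) : Prop :=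
  forall k, S k k = 1%:M /\ forall l, (k < l)%N -> S k l = 0.

Definition binverse (S L : blockmx) : Prop :=
  [/\ lower_unitriangular L,
      bmul S L = bdiag (fun=> 1%:M) & bmul L S = bdiag (fun=> 1%:M)].

(* G = S1^-1 H S2^-T *)
Definition gauss_borel (G S1 : blockmx) (H : nat -> M) (S2 : blockmx) : Prop :=
  [/\ lower_unitriangular S1, lower_unitriangular S2 &
      exists L1 L2, [/\ binverse S1 L1, binverse S2 L2 &
        G = bmul L1 (bmul (bdiag H) (btr L2))]].

(* The factors (S1, H, S2), which exist and are unique for a quasidefinite G. *)
Definition factors (G : blockmx) : blockmx * (nat -> M) * blockmx :=
  match pselect (exists F : blockmx * (nat -> M) * blockmx,
                   gauss_borel G F.1.1 F.1.2 F.2) with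
  | left ex => projT1 (cid ex)
  | right _ => (fun _ _ => 0, fun _ => 0, fun _ _ => 0)
  end.

Definition gbS1 (u : mkernel) (s : times) : blockmx := (factors (gram u s)).1.1.
Definition gbH (u : mkernel) (s : times) : nat -> M := (factors (gram u s)).1.2.
Definition gbS2 (u : mkernel) (s : times) : blockmx := (factors (gram u s)).2.

(** * Biorthogonal polynomials, second kind functions and tau-ratios *)

(* Row n of S chi(x), for S lower triangular. *)
Definition rowpoly (S : blockmx) (n : nat) (x : C) : M :=
  \sum_(k < n.+1) S n k *m (x ^+ k)%:M.

Definition P1 (u : mkernel) (s : times) (n : nat) (x : C) : M :=
  rowpoly (gbS1 u s) n x.
Definition P2 (u : mkernel) (s : times) (n : nat) (y : C) : M :=
  rowpoly (gbS2 u s) n y.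

Definition C1 (u : mkernel) (s : times) (n : nat) (z : C) : M :=
  form (evolved u s) (fun x => P1 u s n x%:C) (fun y => ((z - y%:C)^-1)%:M).
Definition C2 (u : mkernel) (s : times) (n : nat) (z : C) : M :=
  (form (evolved u s) (fun x => ((z - x%:C)^-1)%:M)
     (fun y => P2 u s n y%:C))^T.

(* The index counts factors: tau1 u m t s is tau^(1)_{m-1}(t, s), that is
   A_{m-1} ... A_0, and tau1 u 0 t s = 1. *)
Fixpoint tau1 (u : mkernel) (m : nat) (t s : times) : M :=
  if m is m'.+1 then (gbH u t m' *m invmx (gbH u s m')) *m tau1 u m' t s
  else 1%:M.

Fixpoint tau2 (u : mkernel) (m : nat) (t s : times) : M :=
  if m is m'.+1 then (invmx (gbH u t m') *m gbH u s m') *m tau2 u m' t s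
  else 1%:M.

End Kernels.

(* Main.v *)
Require Import Defs.
From HB Require Import structures.
From mathcomp Require Import all_boot all_order all_algebra.
From mathcomp Require Import all_classical all_reals all_analysis.
From mathcomp Require Import complex.
From mathcomp Require Import ring lra.
Import Order.TTheory GRing.Theory Num.Theory.
Import numFieldNormedType.Exports.
Import ComplexField.Normc.
Local Open Scope classical_set_scope.
Local Open Scope complex_scope.
Local Open Scope ring_scope.

(** A Miwa shift multiplies or divides the kernel by 1 - x/z or 1 - y/z, and the
    four formulas all follow from comparing the orthogonal polynomials of two
    kernels that differ by such a factor.

    Let u' = (1 - x/z) u, with polynomials P'_n, P_n and pivots H'_n, H_n.  The
    polynomial (1 - x/z) P'_n has degree n + 1, leading coefficient -1/z, and is
    orthogonal to 1, ..., y^(n-1) for u.  Hence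
      (1 - x/z) P'_n(x) = H'_n H_n^-1 P_n(x) - z^-1 P_(n+1)(x),
    which is connection_formula.  At x = z it reads
    P_(n+1)(z) = z H'_n H_n^-1 P_n(z), and iterating it from P_0 = 1 gives the
    formula for the first family (rowpoly_shift), with u = u^t and
    u' = u^(t-[z]_1).

    For the second kind functions take u' = u^t and u = u^(t+[z]_1).  Since
    1/(z - x) is z^-1 (1 - x/z)^-1, the function C^[2]_m is z^-1 times the pairing
    of 1 with the m-th dual polynomial of u^t for the kernel u (C2_unshift).
    Pairing the connection formula with that dual polynomial gives a recursion
    that leads from this quantity to the pivot of index m (dual_moment_shift).
    The two formulas in y are the same statements for the transposed Gram
    matrix; transposition turns the ordered product of the ratios into the
    inverse of the product that defines the second tau-ratio
    (ratio_product_tr).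

    Two points remain behind this algebra.  First, the factors S_1, H, S_2 of a
    quasidefinite Gram matrix exist and are characterized by one-sided
    orthogonality (gauss_borel_ex, gauss_borel_rows).  Secondly, the Gram matrix
    of the shifted time really is that of the kernel multiplied by 1 - x/z.  This
    requires the value of the Miwa series, exp(sum_j (x/z)^j / j) = 1/(1 - x/z)
    for |x| < |z| (cexp_miwa_sum), and the linearity of the pairing of a
    distribution with functions smooth near its support.  The latter holds
    because a distribution vanishes on the test functions whose support misses
    its own (distribution_vanish), and because the functions at hand, namely
    exponentials of polynomials, monomials and 1/(1 - x/z), coincide with test
    functions near the support, which is bounded. *)

Set Implicit Arguments.
Unset Strict Implicit.
Unset Printing Implicit Defensive.

(** * Block Gauss-Borel factorization *)

Section BlockFactorization.
Variables (R : realType) (p : nat).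
Local Notation M := 'M[R[i]]_p.
Local Notation bmx := (blockmx R p).
Implicit Types (A B D G S L : bmx) (H : nat -> M).

Lemma truncation_row G k (a : nat -> M) :
  (\mxrow_(i < k) a i) *m truncation G k
    = \mxrow_(l < k) \sum_(j < k) a j *m G j l.
Proof. by rewrite mul_mxrow_mxblock. Qed.

Lemma quasidefinite_unit G k : quasidefinite G -> truncation G k \in unitmx.
Proof.
move=> qG; case: k => [|k]; last by rewrite unitmxE unitfE qG.
suff -> : truncation G 0 = 1%:M by exact: unitmx1.
by apply/matrixP => i; exfalso; move: i; rewrite big_ord0 => -[].
Qed.

(** Quasidefiniteness enters through this uniqueness principle: a matrix
    polynomial of degree below k that is orthogonal to the first k powers is
    zero. *)
Lemma quasidefinite_inj G k (a : nat -> M) : quasidefinite G ->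
  (forall l, (l < k)%N -> \sum_(j < k) a j *m G j l = 0) ->
  forall j, (j < k)%N -> a j = 0.
Proof.
move=> qG aG j jk.
have : (\mxrow_(i < k) a i) *m truncation G k = 0.
  rewrite truncation_row; apply/mxrowP => l.
  by rewrite mxrowK submxrow0 aG.
move=> /(congr1 (mulmxr (invmx (truncation G k)))) /=.
rewrite mulmxK ?quasidefinite_unit// mul0mx => /mxrowP/(_ (Ordinal jk)).
by rewrite mxrowK submxrow0.
Qed.

Lemma quasidefinite_solve G k (b : nat -> M) : quasidefinite G ->
  exists a : nat -> M,
    forall l, (l < k)%N -> \sum_(j < k) a j *m G j l = b l.
Proof.
move=> qG.
pose A : 'M[R[i]]_(p, (\sum_(i < k) p)%N) :=
  (\mxrow_(l < k) b l) *m invmx (truncation G k).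
exists (fun j =>
  if (insub j : option 'I_k) is Some i then submxrow A i else 0) => l lk.
under eq_bigr do rewrite valK.
have : A *m truncation G k = \mxrow_(l < k) b l.
  by rewrite mulmxKV ?quasidefinite_unit.
rewrite -[A]submxrowK mul_mxrow_mxblock => /mxrowP/(_ (Ordinal lk)).
by rewrite !mxrowK submxrowK.
Qed.

Lemma quasidefinite_tr G : quasidefinite G -> quasidefinite (btr G).
Proof.
move=> qG k k0; rewrite -det_tr /truncation tr_mxblock.
rewrite (_ : \mxblock_(i, j) _ = truncation G k) ?qG//.
by apply/eq_mxblock => i j; rewrite /btr trmxK.
Qed.

(** The half of an LDU factorization that only involves one triangular factor:
    row n of S holds the coefficients of the monic matrix polynomial of degree n
    that is orthogonal to the lower powers, and H n is its pivot.  The other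
    half is the same property of the transposed Gram matrix. *)
Definition row_factor G S H : Prop :=
  lower_unitriangular S /\
  forall n l, (l <= n)%N ->
    \sum_(k < n.+1) S n k *m G k l = if l == n then H n else 0.

Lemma quasidefinite_row_factor G : quasidefinite G ->
  exists S H, row_factor G S H.
Proof.
move=> qG.
have /choice[a aP] : forall n, exists a : nat -> M, forall l, (l < n)%N ->
    \sum_(j < n) a j *m G j l = - G n l.
  by move=> n; exact: quasidefinite_solve.
pose S : bmx := fun n k => if (k < n)%N then a n k else (k == n)%:R%:M.
exists S, (fun n => \sum_(k < n.+1) S n k *m G k n); split.
  move=> k; rewrite /S ltnn eqxx; split=> // l kl.
  by rewrite ltnNge ltnW//= gtn_eqF//= mulr0n raddf0.
move=> n l; rewrite leq_eqVlt => /predU1P[->|ln]; first by rewrite eqxx.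
rewrite (ltn_eqF ln) big_ord_recr /= {2}/S ltnn eqxx mul1mx.
under eq_bigr do rewrite /S ltn_ord.
by rewrite aP// addNr.
Qed.

(** If v *m H n = 0, then v times the n-th orthogonal polynomial is orthogonal
    to the first n + 1 powers, so its leading coefficient v vanishes. *)
Lemma row_factor_unit G S H n :
  quasidefinite G -> row_factor G S H -> H n \in unitmx.
Proof.
move=> qG [uS SG]; rewrite -row_free_unit -kermx_eq0; apply/eqP.
set v := kermx _.
have: v *m S n n = 0.
  apply: (quasidefinite_inj (k := n.+1) (a := fun k => v *m S n k) qG) => //.
  move=> l ln; under eq_bigr do rewrite -mulmxA.
  rewrite -mulmx_sumr SG//; case: eqP => _; last by rewrite mulmx0.
  exact: mulmx_ker.
by rewrite (uS n).1 mulmx1.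
Qed.

Lemma sum_ord_widen (V : nmodType) m n (F : nat -> V) : (m <= n)%N ->
  (forall j, (m <= j)%N -> F j = 0) ->
  \sum_(j < m) F j = \sum_(j < n) F j.
Proof.
move=> mn F0; rewrite -(subnKC mn) big_split_ord /= [X in _ + X]big1 ?addr0//.
by move=> i _; rewrite F0// leq_addr.
Qed.

(** The sums of a product stop at the diagonal of its left factor, so the middle
    factor must be lower triangular as well for the two groupings to agree. *)
Lemma bmulA A B D : lower_unitriangular B ->
  bmul A (bmul B D) = bmul (bmul A B) D.
Proof.
move=> uB; apply/funext => k; apply/funext => l; rewrite /bmul.
under eq_bigr => j _ do rewrite mulmx_sumr.
under [RHS]eq_bigr => j _ do rewrite mulmx_suml.
rewrite [RHS]exchange_big /=; apply: eq_bigr => j _.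
under [RHS]eq_bigr do rewrite -mulmxA.
apply: (sum_ord_widen (F := fun i => A k j *m (B j i *m D i l))).
  by rewrite ltn_ord.
by move=> i ji; rewrite (uB j).2// mul0mx mulmx0.
Qed.

Lemma bmul1l B : bmul (bdiag (fun=> 1%:M)) B = B.
Proof.
apply/funext => k; apply/funext => l; rewrite /bmul big_ord_recr /=.
rewrite /bdiag eqxx mul1mx big1 ?add0r// => j _.
by rewrite gtn_eqF ?mul0mx.
Qed.

Lemma bmul1r B : lower_unitriangular B -> bmul B (bdiag (fun=> 1%:M)) = B.
Proof.
move=> uB; apply/funext => k; apply/funext => l; rewrite /bmul /bdiag.
have [lk|kl] := ltnP l k.+1; last first.
  rewrite (uB k).2// big1// => j _; rewrite ltn_eqF ?mulmx0//.
  exact: leq_trans kl.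
rewrite (bigD1 (Ordinal lk))//= eqxx mulmx1 big1 ?addr0// => j jl.
by rewrite ifF ?mulmx0//; apply/negbTE.
Qed.

Lemma bdiag_btr_entry H L n l :
  bmul (bdiag H) (btr L) n l = H n *m (L l n)^T.
Proof.
rewrite /bmul big_ord_recr /= /bdiag eqxx big1 ?add0r// => j _.
by rewrite gtn_eqF// mul0mx.
Qed.

(** Forward substitution: row n of the inverse is determined by the rows
    above it. *)
Lemma right_inverse_ex S : lower_unitriangular S ->
  exists2 L, lower_unitriangular L & bmul S L = bdiag (fun=> 1%:M).
Proof.
move=> uS.
(* T n is correct in its rows below n; this avoids a well-founded recursion *)
have [T TP] : exists T : nat -> bmx, forall n,
    T n.+1 = fun k l => if k == n then (if k == l then 1%:M else 0)
        - \sum_(j < n) S n j *m T n j l else T n k l.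
  exists (fix T n := if n is m.+1 then
    fun k l => if k == m then (if k == l then 1%:M else 0)
        - \sum_(j < m) S m j *m T m j l else T m k l else fun _ _ => 0).
  by [].
have Tstab n k l : (k < n)%N -> T n k l = T k.+1 k l.
  elim: n => // n IHn; rewrite ltnS leq_eqVlt => /predU1P[->//|kn].
  by rewrite TP (ltn_eqF kn) IHn.
pose L : bmx := fun k l => T k.+1 k l.
have LP n l : L n l
    = (if n == l then 1%:M else 0) - \sum_(j < n) S n j *m L j l.
  rewrite {1}/L TP eqxx; congr (_ - _); apply: eq_bigr => j _.
  by rewrite Tstab.
have L0 l n : (n < l)%N -> L n l = 0.
  elim/ltn_ind: n => n IHn nl; rewrite LP (ltn_eqF nl) big1 ?subr0// => j _.
  by rewrite IHn ?mulmx0//; exact: ltn_trans nl.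
exists L.
  move=> k; split; last by move=> l; exact: L0.
  rewrite LP eqxx big1 ?subr0// => j _.
  by rewrite L0 ?mulmx0.
apply/funext => k; apply/funext => l.
by rewrite /bmul big_ord_recr /= (uS k).1 mul1mx LP addrC subrK.
Qed.

(** A left inverse is obtained from a right inverse as in a group: the right
    inverse has itself a right inverse, which must be S. *)
Lemma binverse_ex S : lower_unitriangular S -> exists L, binverse S L.
Proof.
move=> uS; have [L uL SL] := right_inverse_ex uS.
have [N uN LN] := right_inverse_ex uL.
exists L; split=> //.
suff -> : S = N by [].
by rewrite -[S]bmul1r// -LN bmulA// SL bmul1l.
Qed.

(** The two families of orthogonal polynomials are biorthogonal: pairing the
    n-th one of the first family with the m-th one of the second vanishes for
    m < n by the orthogonality of the former, and for n < m by that of the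
    latter.  Hence S1 G S2^T is diagonal. *)
Lemma gauss_borel_ex G : quasidefinite G ->
  exists F : bmx * (nat -> M) * bmx, gauss_borel G F.1.1 F.1.2 F.2.
Proof.
move=> qG.
have [S1 [H1 [uS1 S1G]]] := quasidefinite_row_factor qG.
have [S2 [H2 [uS2 S2G]]] := quasidefinite_row_factor (quasidefinite_tr qG).
have [L1 iL1] := binverse_ex uS1; have [L2 iL2] := binverse_ex uS2.
have [uL1 SL1 LS1] := iL1; have [uL2 SL2 LS2] := iL2.
exists (S1, H1, S2); split=> //=; exists L1, L2; split=> //.
suff E : bmul S1 G = bmul (bdiag H1) (btr L2).
  by rewrite -E bmulA// LS1 bmul1l.
have S1GS2 n m : \sum_(l < m.+1) bmul S1 G n l *m (S2 m l)^T
    = if n == m then H1 n else 0.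
  have [mn|mn] := leqP m n.
    rewrite big_ord_recr /= (uS2 m).1 trmx1 mulmx1 /bmul S1G// big1 ?add0r.
      by rewrite eq_sym.
    move=> l _; have ln : (l < n)%N by exact: leq_trans mn.
    by rewrite S1G ?(ltn_eqF ln) ?mul0mx// ltnW.
  rewrite (ltn_eqF mn) /bmul.
  under eq_bigr => l _ do rewrite mulmx_suml.
  rewrite exchange_big /= big1// => k _.
  under eq_bigr => l _ do rewrite -mulmxA -[G k l]trmxK -trmx_mul.
  rewrite -mulmx_sumr -raddf_sum /=.
  have kn : (k < m)%N by exact: leq_trans mn.
  have := S2G m k (ltnW kn); rewrite /btr (ltn_eqF kn) => ->.
  by rewrite trmx0 mulmx0.
apply/funext => n; apply/funext => l.
transitivity (\sum_(m < l.+1) (if n == m then H1 n else 0) *m (L2 l m)^T).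
  under eq_bigr => m _ do rewrite -S1GS2 mulmx_suml.
  have W (m : 'I_l.+1) : \sum_(i < m.+1) bmul S1 G n i *m (S2 m i)^T *m (L2 l m)^T
      = \sum_(i < l.+1) bmul S1 G n i *m (S2 m i)^T *m (L2 l m)^T.
    apply: (sum_ord_widen
      (F := fun i => bmul S1 G n i *m (S2 m i)^T *m (L2 l m)^T)) => // j mj.
    by rewrite (uS2 m).2// trmx0 mulmx0 mul0mx.
  under eq_bigr => m _ do rewrite W.
  rewrite exchange_big /=.
  under eq_bigr => i _ do under eq_bigr => m _ do rewrite -mulmxA -trmx_mul.
  under eq_bigr => i _ do rewrite -mulmx_sumr -raddf_sum /=.
  have E i : \sum_(m < l.+1) L2 l m *m S2 m i = if l == i then 1%:M else 0.
    by have := congr1 (fun B : bmx => B l i) LS2.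
  under eq_bigr => i _ do rewrite E.
  rewrite big_ord_recr /= eqxx trmx1 mulmx1 big1 ?add0r// => i _.
  by rewrite gtn_eqF// trmx0 mulmx0.
rewrite bdiag_btr_entry.
have [nl|ln] := ltnP n l.+1; last first.
  rewrite (uL2 l).2// trmx0 mulmx0 big1// => m _.
  by rewrite gtn_eqF ?mul0mx//; exact: leq_trans ln.
rewrite (bigD1 (Ordinal nl))//= eqxx big1 ?addr0// => m mn.
by rewrite ifF ?mul0mx//; apply/negbTE; rewrite eq_sym.
Qed.

Lemma gauss_borel_rows G S1 H S2 : gauss_borel G S1 H S2 ->
  row_factor G S1 H /\ row_factor (btr G) S2 (fun n => (H n)^T).
Proof.
move=> [uS1 uS2 [L1 [L2 [[uL1 SL1 LS1] [uL2 SL2 LS2] GE]]]].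
have E n l : bmul S1 G n l = H n *m (L2 l n)^T.
  by rewrite -bdiag_btr_entry GE bmulA// SL1 bmul1l.
split; split=> // n l ln.
  transitivity (bmul S1 G n l) => //; rewrite E.
  case: eqVneq => [->|lNn]; first by rewrite (uL2 n).1 trmx1 mulmx1.
  by rewrite (uL2 l).2 ?trmx0 ?mulmx0// ltn_neqAle lNn.
(* G S2^T = L1 H *)
have E2 k : \sum_(j < n.+1) G k j *m (S2 n j)^T
    = L1 k n *m H n.
  have -> : G = bmul L1 (bmul S1 G) by rewrite bmulA// LS1 bmul1l.
  rewrite {1}/bmul.
  under eq_bigr => j _ do rewrite mulmx_suml.
  rewrite exchange_big /=.
  under eq_bigr => i _ do under eq_bigr => j _ do
    rewrite E -!mulmxA -trmx_mul.
  under eq_bigr => i _ do rewrite -!mulmx_sumr -raddf_sum /=.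
  have F i : \sum_(j < n.+1) S2 n j *m L2 j i = if n == i then 1%:M else 0.
    by have := congr1 (fun B : bmx => B n i) SL2.
  under eq_bigr => i _ do rewrite F.
  have [nk|kn] := ltnP n k.+1; last first.
    rewrite (uL1 k).2// mul0mx big1// => i _.
    by rewrite gtn_eqF ?trmx0 ?mulmx0//; exact: leq_trans kn.
  rewrite (bigD1 (Ordinal nk))//= eqxx trmx1 mulmx1 big1 ?addr0// => m mn.
  by rewrite ifF ?trmx0 ?mulmx0//; apply/negbTE; rewrite eq_sym.
have -> : \sum_(k < n.+1) S2 n k *m btr G k l = (L1 l n *m H n)^T.
  rewrite -E2 raddf_sum /=; apply: eq_bigr => k _.
  by rewrite trmx_mul trmxK.
case: eqVneq => [->|lNn]; first by rewrite (uL1 n).1 mul1mx.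
by rewrite (uL1 l).2 ?mul0mx ?trmx0// ltn_neqAle lNn.
Qed.

Lemma factorsP G : quasidefinite G ->
  gauss_borel G (factors G).1.1 (factors G).1.2 (factors G).2.
Proof.
move=> qG; rewrite /factors; case: pselect => [ex|[]].
  exact: (projT2 (cid ex)).
exact: gauss_borel_ex.
Qed.

End BlockFactorization.

(** * Multiplication of the kernel by 1 - x/z *)

Section ShiftedFactorization.
Variables (R : realType) (p : nat).
Local Notation M := 'M[R[i]]_p.
Local Notation bmx := (blockmx R p).
Variable z : R[i].
Hypothesis z0 : z != 0.

Fixpoint ratio_product (A : nat -> M) (m : nat) : M :=
  if m is k.+1 then A k *m ratio_product A k else 1%:M.

Lemma ratio_product_unit A m :
  (forall k, A k \in unitmx) -> ratio_product A m \in unitmx.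
Proof.
by move=> uA; elim: m => [|m IHm] /=; rewrite ?unitmx1// unitmx_mul uA.
Qed.

Lemma invmx_mul (A B : M) : A \in unitmx -> B \in unitmx ->
  invmx (A *m B) = invmx B *m invmx A.
Proof.
move=> uA uB; have uAB : A *m B \in unitmx by rewrite unitmx_mul uA.
apply: (can_inj (mulKmx uAB)).
rewrite mulmxV// mulmxA -(mulmxA A) mulmxV// mulmx1.
by rewrite mulmxV.
Qed.

(** Transposition reverses the order of the factors, and so does inversion. *)
Lemma ratio_product_tr (H K : nat -> M) m :
  (forall k, H k \in unitmx) -> (forall k, K k \in unitmx) ->
  (ratio_product (fun k => (H k)^T *m invmx (K k)^T) m)^T
    = invmx (ratio_product (fun k => invmx (H k) *m K k) m).
Proof.
move=> uH uK; elim: m => [|m IHm] /=; first by rewrite trmx1 invmx1.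
have uHK k : invmx (H k) *m K k \in unitmx.
  by rewrite unitmx_mul unitmx_inv uH uK.
rewrite trmx_mul IHm invmx_mul ?ratio_product_unit//; congr (_ *m _).
by rewrite invmx_mul ?unitmx_inv// invmxK trmx_mul trmx_inv !trmxK.
Qed.

(** G' is the Gram matrix of the kernel of G multiplied by 1 - x/z. *)
Definition shifted (G G' : bmx) : Prop :=
  forall k l, G' k l = G k l - z^-1 *: G k.+1 l.

Variables (G G' S S' : bmx) (H H' : nat -> M).
Hypotheses (qG : quasidefinite G) (qG' : quasidefinite G').
Hypotheses (SG : row_factor G S H) (SG' : row_factor G' S' H').
Hypothesis GG' : shifted G G'.

Let A n := H' n *m invmx (H n).

(** In terms of matrix polynomials this is the connection formula
    (1 - x/z) P'_n(x) = H'_n H_n^-1 P_n(x) - z^-1 P_(n+1)(x).  The left-hand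
    side has degree n + 1 and is orthogonal, for the kernel of G, to the powers
    below n; subtracting the two terms on the right removes its leading
    coefficient and its product with the n-th power, and nothing is left by
    quasidefiniteness.  It is stated for the values of an arbitrary functional
    x^k |-> F k, because it is used both for the evaluation at z and for the
    pairing with a dual polynomial. *)
Lemma connection_formula n (F : nat -> M) :
  \sum_(k < n.+1) S' n k *m (F k - z^-1 *: F k.+1)
  = A n *m (\sum_(k < n.+1) S n k *m F k)
    - z^-1 *: \sum_(k < n.+2) S n.+1 k *m F k.
Proof.
have [uS SGE] := SG; have [uS' SGE'] := SG'.
(* r and d are the coefficients of (1 - x/z) P'_n and of the difference of
   the two sides *)
pose r k := S' n k - z^-1 *: (if k is j.+1 then S' n j else 0).
have rE (E : nat -> M) : \sum_(k < n.+1) S' n k *m (E k - z^-1 *: E k.+1)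
    = \sum_(k < n.+2) r k *m E k.
  under [RHS]eq_bigr do rewrite mulmxBl.
  under [LHS]eq_bigr do rewrite mulmxBr.
  rewrite !sumrB; congr (_ - _).
    by rewrite [RHS]big_ord_recr /= (uS' n).2// mul0mx addr0.
  rewrite [RHS]big_ord_recl /= scaler0 mul0mx add0r; apply: eq_bigr => k _.
  by rewrite -scalemxAl -scalemxAr.
pose d k := r k - A n *m S n k + z^-1 *: S n.+1 k.
have dE (E : nat -> M) : \sum_(k < n.+2) d k *m E k =
    \sum_(k < n.+2) r k *m E k - A n *m (\sum_(k < n.+1) S n k *m E k)
    + z^-1 *: \sum_(k < n.+2) S n.+1 k *m E k.
  under eq_bigr do rewrite mulmxDl mulmxBl.
  rewrite big_split /= sumrB; congr (_ - _ + _).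
    rewrite [X in _ = _ *m X](_ : _ = \sum_(k < n.+2) S n k *m E k).
      by rewrite mulmx_sumr; apply: eq_bigr => k _; rewrite mulmxA.
    by rewrite [RHS]big_ord_recr /= (uS n).2// mul0mx addr0.
  by rewrite scaler_sumr; apply: eq_bigr => k _; rewrite scalemxAl.
have dtop : d n.+1 = 0.
  rewrite /d /r (uS' n).2// (uS n).2// (uS' n).1 (uS n.+1).1 mulmx0.
  by rewrite sub0r subr0 addNr.
have d0 : forall k, (k < n.+1)%N -> d k = 0.
  apply: (quasidefinite_inj qG) => l ln.
  have := dE (fun k => G k l); rewrite big_ord_recr /= dtop mul0mx addr0 => ->.
  rewrite -(rE (fun k => G k l)).
  have -> : \sum_(k < n.+1) S' n k *m (G k l - z^-1 *: G k.+1 l)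
      = if l == n then H' n else 0.
    by rewrite -SGE'//; apply: eq_bigr => k _; rewrite GG'.
  rewrite SGE// SGE; last exact: ltnW.
  rewrite (ltn_eqF ln) scaler0 addr0; case: eqP => _; last first.
    by rewrite mulmx0 subr0.
  by rewrite /A mulmxKV ?subrr//; exact: row_factor_unit SG.
rewrite rE; apply/eqP; rewrite -subr_eq0 opprD opprK addrA -dE.
rewrite big1// => k _; have := ltn_ord k.
rewrite ltnS leq_eqVlt => /predU1P[->|kn]; first by rewrite dtop mul0mx.
by rewrite d0// mul0mx.
Qed.

(** At x = z the left-hand side of the connection formula vanishes, so
    P_(n+1)(z) = z H'_n H_n^-1 P_n(z). *)
Lemma rowpoly_shift n : rowpoly S n z = z ^+ n *: ratio_product A n.
Proof.
elim: n => [|n IHn] /=.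
  by rewrite /rowpoly big_ord1 (SG.1 0%N).1 mul1mx expr0 scale1r.
have := connection_formula n (fun k => (z ^+ k)%:M).
rewrite big1 => [|k _]; last first.
  by rewrite scale_scalar_mx exprS mulKf// subrr mulmx0.
rewrite -/(rowpoly S n z) -/(rowpoly S n.+1 z) IHn => /eqP.
rewrite eq_sym subr_eq0 => /eqP E.
rewrite -[LHS]scale1r -(mulfV z0) -scalerA -E -scalemxAr scalerA.
by rewrite -exprS.
Qed.

(** Let V_n be the pairing, for the kernel of G, of P_n with the m-th dual
    polynomial of G'.  The connection formula gives V_(n+1) = z A_n V_n as long
    as n < m, since (1 - x/z) P'_n is paired with that dual polynomial as P'_n
    is for the kernel of G'.  The recursion starts at the pairing with the
    constant 1, which is a second kind function, and ends at V_m = H_m, the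
    dual polynomial being monic. *)
Lemma dual_moment_shift (S2 : bmx) m :
  row_factor (btr G') S2 (fun n => (H' n)^T) ->
  H m = z ^+ m *: (ratio_product A m
          *m \sum_(l < m.+1) G 0%N l *m (S2 m l)^T).
Proof.
move=> [uS2 S2G].
pose F k := \sum_(l < m.+1) G k l *m (S2 m l)^T.
pose V n := \sum_(k < n.+1) S n k *m F k.
have V0 : V 0%N = F 0%N by rewrite /V big_ord1 (SG.1 0%N).1 mul1mx.
have Vm : V m = H m.
  rewrite /V; under eq_bigr do rewrite mulmx_sumr.
  rewrite exchange_big /= big_ord_recr /=.
  under [X in _ + X]eq_bigr do rewrite mulmxA.
  rewrite -mulmx_suml SG.2// eqxx (uS2 m).1 trmx1 mulmx1 big1 ?add0r// => l _.
  under eq_bigr do rewrite mulmxA.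
  by rewrite -mulmx_suml SG.2 ?(ltn_eqF (ltn_ord l)) ?mul0mx// ltnW.
have VS n : (n < m)%N -> V n.+1 = z *: (A n *m V n).
  move=> nm; have := connection_formula n F.
  rewrite big1 => [|k _]; last first.
    rewrite /F scaler_sumr -sumrB.
    under eq_bigr => l _ do rewrite scalemxAl -mulmxBl -GG' -[G' k l]trmxK
      -trmx_mul.
    have km : (k < m)%N by apply: leq_trans nm.
    rewrite -raddf_sum /=.
    have := S2G m k (ltnW km); rewrite (ltn_eqF km) /btr => ->.
    by rewrite trmx0 mulmx0.
  rewrite -/(V n) -/(V n.+1) => /eqP; rewrite eq_sym subr_eq0 => /eqP ->.
  by rewrite scalerA mulfV// scale1r.
suff VE n : (n <= m)%N -> V n = z ^+ n *: (ratio_product A n *m F 0%N).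
  by rewrite -Vm VE.
elim: n => [|n IHn] nm; first by rewrite V0 /= mul1mx scale1r.
by rewrite VS// IHn 1?ltnW// -scalemxAr scalerA -exprS mulmxA.
Qed.

End ShiftedFactorization.

(** * Smooth functions of two real variables *)

Section SmoothFunctions.
Variable R : realType.
Local Notation plane := (R * R)%type.
Implicit Types (g : plane -> R) (h : R -> R).

Definition axis (b : bool) : plane := if b then (1, 0) else (0, 1).

Lemma CnSE n g : Cn n.+1 g <-> continuous g /\
  forall b, (forall q, derivable g q (axis b)) /\
            Cn n (fun q => 'D_(axis b) g q).
Proof.
split=> [[cg [d1 d2 c1 c2]]|[cg D]]; split; try exact: cg.
  by case; split; [exact: d1|exact: c1|exact: d2|exact: c2].
by split; [exact: (D true).1 | exact: (D false).1
                      |exact: (D true).2 | exact: (D false).2].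
Qed.

Lemma Cn_cont n g : Cn n g -> continuous g.
Proof. by case: n => [|n] []. Qed.

Lemma CnS_intro n g (dg : bool -> plane -> R) : continuous g ->
  (forall b q, is_derive q (axis b) g (dg b q)) ->
  (forall b, Cn n (dg b)) -> Cn n.+1 g.
Proof.
move=> cg D C; apply/CnSE; split=> // b; split=> [q|].
  by have [] := D b q.
suff -> : (fun q => 'D_(axis b) g q) = dg b by [].
by apply/funext => q; have [] := D b q.
Qed.

Lemma CnS_derive n g b q : Cn n.+1 g -> is_derive q (axis b) g ('D_(axis b) g q).
Proof. by move=> /CnSE[_ /(_ b)[D _]]; exact: derivableP. Qed.

Lemma CnS_deriv n g b : Cn n.+1 g -> Cn n (fun q => 'D_(axis b) g q).
Proof. by move=> /CnSE[_ /(_ b)[]]. Qed.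

Lemma CnW n g : Cn n.+1 g -> Cn n g.
Proof.
elim: n g => [|n IHn] g gC; first by split; [exact: Cn_cont gC|].
apply: (CnS_intro (dg := fun b q => 'D_(axis b) g q)).
- exact: Cn_cont gC.
- by move=> b q; exact: CnS_derive gC.
- by move=> b; apply: IHn; exact: CnS_deriv.
Qed.

Lemma Cn_cst n (c : R) : Cn n (fun=> c).
Proof.
elim: n c => [|n IHn] c; first by split=> //; exact: cst_continuous.
apply: (CnS_intro (dg := fun _ _ => 0)) => //; exact: cst_continuous.
Qed.

Lemma CnD n g1 g2 : Cn n g1 -> Cn n g2 -> Cn n (fun q => g1 q + g2 q).
Proof.
elim: n g1 g2 => [|n IHn] g1 g2 C1 C2.
  split=> // q; apply: continuousD; first exact: (Cn_cont C1).
  exact: (Cn_cont C2).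
apply: (CnS_intro
  (dg := fun b q => 'D_(axis b) g1 q + 'D_(axis b) g2 q)).
- move=> q; apply: continuousD; first exact: (Cn_cont C1).
  exact: (Cn_cont C2).
- move=> b q; exact: (is_deriveD (CnS_derive b q C1) (CnS_derive b q C2)).
- by move=> b; apply: IHn; exact: CnS_deriv.
Qed.

Lemma CnM n g1 g2 : Cn n g1 -> Cn n g2 -> Cn n (fun q => g1 q * g2 q).
Proof.
elim: n g1 g2 => [|n IHn] g1 g2 C1 C2.
  split=> // q; apply: continuousM; first exact: (Cn_cont C1).
  exact: (Cn_cont C2).
apply: (CnS_intro
  (dg := fun b q => g1 q * 'D_(axis b) g2 q + g2 q * 'D_(axis b) g1 q)).
- move=> q; apply: continuousM; first exact: (Cn_cont C1).
  exact: (Cn_cont C2).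
- move=> b q; exact: (is_deriveM (CnS_derive b q C1) (CnS_derive b q C2)).
- move=> b; apply: CnD; apply: IHn; try exact: CnS_deriv; exact: CnW.
Qed.

Lemma CnN n g : Cn n g -> Cn n (fun q => - g q).
Proof.
move=> gC; rewrite (_ : (fun q => _) = fun q => (-1) * g q).
  by apply: CnM => //; exact: Cn_cst.
by apply/funext => q; rewrite mulN1r.
Qed.

Lemma CnB n g1 g2 : Cn n g1 -> Cn n g2 -> Cn n (fun q => g1 q - g2 q).
Proof. by move=> C1 C2; apply: CnD => //; exact: CnN. Qed.

Lemma CnX n g k : Cn n g -> Cn n (fun q => g q ^+ k).
Proof.
move=> gC; elim: k => [|k IHk]; first exact: Cn_cst.
rewrite (_ : (fun q => _) = fun q => g q * g q ^+ k); first exact: CnM.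
by apply/funext => q; rewrite exprS.
Qed.

Lemma CnV n g : (forall q, g q != 0) -> Cn n g -> Cn n (fun q => (g q)^-1).
Proof.
move=> g0; elim: n => [|n IHn] gC.
  by split=> // q; apply: continuousV => //; exact: (Cn_cont gC).
apply: (CnS_intro
  (dg := fun b q => - ((g q)^-1 ^+ 2) * 'D_(axis b) g q)).
- by move=> q; apply: continuousV => //; exact: (Cn_cont gC).
- move=> b q; rewrite exprVn; have [D _] := CnS_derive b q gC.
  by apply: DeriveDef; [exact: derivableV|rewrite deriveV].
- move=> b; apply: CnM; last exact: CnS_deriv.
  by apply/CnN/CnX/IHn/CnW.
Qed.

Lemma Cn_linear n (f : {linear plane -> R}) : continuous f -> Cn n f.
Proof.
move=> fc; case: n => [|n]; first by split.
apply: (CnS_intro (dg := fun b _ => f (axis b))) => // [b q|b].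
  apply: DeriveDef; first exact/diff_derivable/linear_differentiable.
  by rewrite deriveE ?diff_lin//; exact: linear_differentiable.
exact: Cn_cst.
Qed.

Lemma Cn_fst n : Cn n (fun q : plane => q.1).
Proof. by apply: (@Cn_linear n fst) => q; exact: cvg_fst. Qed.

Lemma Cn_snd n : Cn n (fun q : plane => q.2).
Proof. by apply: (@Cn_linear n snd) => q; exact: cvg_snd. Qed.

(** Infinite differentiability, stated coinductively: no iterated derivative has
    to be computed, it suffices to exhibit a family stable under derivation. *)
Definition smooth1 h := exists S : set (R -> R), S h /\
  forall f, S f -> exists2 f', S f' & forall x : R, is_derive x 1 f (f' x).

Lemma derive_line g q v : 'D_v g q = 'D_1 (fun s : R => g (s *: v + q)) 0.
Proof.
rewrite /derive; set f1 := fun s => s^-1 *: _; set f2 := fun s => s^-1 *: _.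
suff -> : f1 = f2 by [].
by apply/funext => s; rewrite /f1 /f2 /= addr0 scale0r add0r [_%:A]mulr1.
Qed.

Lemma is_derive_line g q v a :
  is_derive q v g a <-> is_derive (0 : R) 1 (fun s : R => g (s *: v + q)) a.
Proof.
split=> -[D E]; apply: DeriveDef; first exact/(derivable1P g q v).
- by rewrite -(derive_line g q v).
- exact/(derivable1P g q v).
- by rewrite (derive_line g q v).
Qed.

(** A directional derivative is a derivative along a line, where the chain rule
    in one variable applies. *)
Lemma is_derive_comp_plane h g q v (a b : R) :
  is_derive (g q) 1 h a -> is_derive q v g b -> is_derive q v (h \o g) (a * b).
Proof.
move=> Dh /is_derive_line Dg; apply/is_derive_line.
apply: (@is_derive1_comp _ h (fun s : R => g (s *: v + q))) => //.
by rewrite scale0r add0r.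
Qed.

Lemma Cn_comp n h g : smooth1 h -> Cn n g -> Cn n (fun q => h (g q)).
Proof.
move=> [S [Sh SS]]; elim: n h g Sh => [|n IHn] h g Sh gC.
  split=> // q; apply: continuous_comp; first exact: (Cn_cont gC).
  have [h' _ Dh] := SS _ Sh.
  by apply/differentiable_continuous/derivable1_diffP; have [] := Dh (g q).
have [h' Sh' Dh] := SS _ Sh.
apply: (CnS_intro (dg := fun b q => h' (g q) * 'D_(axis b) g q)).
- move=> q; apply: continuous_comp; first exact: (Cn_cont gC).
  by apply/differentiable_continuous/derivable1_diffP; have [] := Dh (g q).
- by move=> b q; apply: is_derive_comp_plane => //; exact: CnS_derive gC.
- move=> b; apply: CnM; last exact: CnS_deriv.
  by apply: IHn => //; exact: CnW.
Qed.

Lemma smooth1_expR : smooth1 (@expR R).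
Proof.
exists [set @expR R]; split=> // f ->; exists (@expR R) => // x.
exact: is_derive_expR.
Qed.

Let trig : set (R -> R) :=
  [set f | exists a b : R, f = (fun x => a * cos x + b * sin x)].

Let trig_derive f : trig f ->
  exists2 f', trig f' & forall x : R, is_derive x 1 f (f' x).
Proof.
move=> [a [b ->]]; exists (fun x => b * cos x + (- a) * sin x).
  by exists b, (- a).
move=> x.
have D := is_deriveD (is_deriveM (is_derive_cst a x 1) (is_derive_cos x))
  (is_deriveM (is_derive_cst b x 1) (is_derive_sin x)).
apply: (is_derive_eq D).
by rewrite /cst /= !scaler0 !addr0 /GRing.scale /= mulrN addrC mulNr.
Qed.

Lemma smooth1_cos : smooth1 (@cos R).
Proof.
exists trig; split; last exact: trig_derive.
by exists 1, 0; apply/funext => x; rewrite mul1r mul0r addr0.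
Qed.

Lemma smooth1_sin : smooth1 (@sin R).
Proof.
exists trig; split; last exact: trig_derive.
by exists 0, 1; apply/funext => x; rewrite mul1r mul0r add0r.
Qed.

End SmoothFunctions.

(** * Smooth plateaus *)

Section Plateau.
Variable R : realType.
Local Notation plane := (R * R)%type.
Implicit Types (P : {poly R}).

(** The functions P(1/x) exp(-1/x), extended by 0 to x <= 0, are stable under
    derivation, which makes exp(-1/x) infinitely differentiable. *)
Definition flat P (x : R) : R :=
  if 0 < x then P.[x^-1] * expR (- x^-1) else 0.

Lemma horner_le_expR P : exists2 c : R, 0 <= c &
  forall y, 0 <= y -> `|P.[y]| <= c * expR y.
Proof.
exists (\sum_(i < size P) `|P`_i| * i`!%:R).
  by apply: sumr_ge0 => i _; exact: mulr_ge0.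
move=> y y0; rewrite horner_coef mulr_suml.
apply: le_trans (ler_norm_sum _ _ _) _; apply: ler_sum => i _.
rewrite normrM -mulrA; apply: ler_wpM2l => //.
rewrite ger0_norm ?exprn_ge0//; case: (nat_of_ord i) => [|k].
  by rewrite expr0 mul1r; apply: le_trans (expR_ge1Dx y); rewrite lerDl.
rewrite mulrC -ler_pdivrMr ?ltr0n ?fact_gt0//.
by apply: le_trans (expR_ge1Dxn k y0); rewrite lerDr.
Qed.

(** y P(y) = O(exp y) at infinity, with y = 1/x. *)
Lemma flat_le P : exists2 c : R, 0 <= c & forall x, `|flat P x| <= c * `|x|.
Proof.
have [c c0 cP] := horner_le_expR ('X * P); exists c => // x.
rewrite /flat; case: ifPn => [x0|_]; last by rewrite normr0 mulr_ge0.
have := cP x^-1; rewrite invr_ge0 ltW// => /(_ isT).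
rewrite hornerM hornerX normrM gtr0_norm ?invr_gt0// => H.
rewrite normrM (gtr0_norm x0) (gtr0_norm (expR_gt0 _)) expRN.
by rewrite ler_pdivrMr ?expR_gt0// mulrAC -ler_pdivrMr// mulrC.
Qed.

(** At 0 the difference quotient of flat P is flat ('X * P), which tends to 0
    by flat_le. *)
Lemma flat_derive P (x : R) :
  is_derive x 1 (flat P) (flat ('X ^+ 2 * (P - P^`())) x).
Proof.
have [x0|x0|->] := ltgtP x 0.
- rewrite /flat (lt_gtF x0); apply: (@near_eq_is_derive _ _ _ (cst 0)).
  near=> y; rewrite /= ifF//; apply: lt_gtF; near: y.
  exact: lt_nbhsl.
- pose f (y : R) := P.[y^-1] * expR (- y^-1).
  apply: (@near_eq_is_derive _ _ _ f).
    by near=> y; rewrite /flat /f ifT//; near: y; exact: lt_nbhsr.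
  have xN0 : x != 0 by rewrite gt_eqF.
  have Dv : is_derive x 1 (fun y : R => y^-1) (- x ^- 2).
    have := @is_deriveV _ id x 1 1 xN0 (is_derive_id _ _).
    by rewrite /= /GRing.scale /= mulr1.
  have D1 := is_derive1_comp (is_derive_poly P x^-1) Dv.
  have DN : is_derive x 1 (fun y : R => - y^-1) (x ^- 2).
    by have := is_deriveN Dv; rewrite opprK.
  have D2 := @is_derive1_comp _ expR (fun y => - y^-1) x _ _ (is_derive_expR _) DN.
  apply: (is_derive_eq (is_deriveM D1 D2)).
  rewrite /flat x0 /GRing.scale /= !hornerE /=.
  rewrite -exprVn; ring.
- have -> : flat ('X ^+ 2 * (P - P^`())) 0 = 0 by rewrite /flat ltxx.
  have [c c0 cP] := flat_le ('X * P).
  have E : (fun h : R => h^-1 *: ((flat P \o shift 0) h%:A - flat P 0)) @ 0^' --> 0.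
    apply/cvgrPdist_le => e e0; near=> h.
    have hN0 : h != 0 by near: h; exact: nbhs_dnbhs_neq.
    rewrite sub0r normrN /= addr0 {2}/flat ltxx subr0.
    rewrite [h%:A]mulr1.
    have -> : h^-1 *: flat P h = flat ('X * P) h.
      rewrite /flat /GRing.scale /=; case: ifP => _; rewrite ?mulr0//.
      by rewrite hornerM hornerX mulrA.
    apply: le_trans (cP h) _.
    apply: (@le_trans _ _ ((c + 1) * `|h|)); first by rewrite ler_wpM2r// lerDl.
    rewrite mulrC -ler_pdivlMr ?ltr_wpDl//.
    near: h; apply: nbhs_dnbhs.
    have ec0 : 0 < e / (c + 1) by rewrite divr_gt0// ltr_wpDl.
    by apply: filterS (nbhsx_ballx (0 : R) _ ec0) => h /=;
      rewrite /ball /= sub0r normrN => /ltW.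
  apply: DeriveDef; first by apply/cvg_ex; exists 0.
  by apply: cvg_lim.
Unshelve. all: by end_near.
Qed.

Lemma smooth1_flat P : smooth1 (flat P).
Proof.
exists [set f | exists P, f = flat P]; split; first by exists P.
move=> _ [Q ->]; exists (flat ('X ^+ 2 * (Q - Q^`()))); first by eexists.
exact: flat_derive.
Qed.

Lemma flat1E (x : R) : flat 1 x = if 0 < x then expR (- x^-1) else 0.
Proof. by rewrite /flat hornerC mul1r. Qed.

Lemma flat1_le0 (x : R) : x <= 0 -> flat 1 x = 0.
Proof. by rewrite flat1E => x0; rewrite ltNge x0. Qed.

Lemma flat1_gt0 (x : R) : 0 < x -> 0 < flat 1 x.
Proof. by rewrite flat1E => ->; exact: expR_gt0. Qed.

Lemma flat1_ge0 (x : R) : 0 <= flat 1 x.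
Proof.
by case: (leP x 0) => x0; [rewrite flat1_le0|exact/ltW/flat1_gt0].
Qed.

Lemma flat1_homo (x y : R) : x <= y -> flat 1 x <= flat 1 y.
Proof.
have [x0 _|x0 xy] := leP x 0; first by rewrite flat1_le0// flat1_ge0.
have y0 := lt_le_trans x0 xy.
by rewrite !flat1E x0 y0 ler_expR lerN2 lef_pV2// posrE.
Qed.

(** For a < b, a smooth step equal to 1 up to a and to 0 from b on.  Composing flat 1 with
    itself avoids a quotient of functions. *)
Definition plateau (a b x : R) : R :=
  flat 1 (1 - flat 1 (x - a) / flat 1 (b - a)) / flat 1 1.

Lemma plateau_in a b x : x <= a -> plateau a b x = 1.
Proof.
move=> xa; rewrite /plateau [flat 1 (x - a)]flat1_le0 ?subr_le0//.
rewrite mul0r subr0 divff//.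
by rewrite gt_eqF// flat1_gt0.
Qed.

Lemma plateau_out a b x : a < b -> b <= x -> plateau a b x = 0.
Proof.
move=> ab bx; rewrite /plateau [flat 1 (1 - _)]flat1_le0 ?mul0r// subr_le0.
by rewrite ler_pdivlMr ?mul1r ?flat1_homo ?flat1_gt0 ?subr_gt0// lerB.
Qed.

Lemma plateau_le1 a b x : a < b -> plateau a b x <= 1.
Proof.
move=> ab; rewrite /plateau ler_pdivrMr ?flat1_gt0// mul1r flat1_homo//.
by rewrite gerBl divr_ge0 ?flat1_ge0.
Qed.

Lemma Cn_plateau n a b (g : plane -> R) :
  Cn n g -> Cn n (fun q => plateau a b (g q)).
Proof.
move=> gC; apply: CnM; last exact: Cn_cst.
apply: Cn_comp; first exact: smooth1_flat.
apply: CnB; first exact: Cn_cst.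
apply: CnM; last exact: Cn_cst.
apply: Cn_comp; first exact: smooth1_flat.
by apply: CnB => //; exact: Cn_cst.
Qed.

End Plateau.

(** * Distributions and functions smooth near their support *)

Section Distributions.
Variable R : realType.
Local Notation C := R[i].
Local Notation plane := (R * R)%type.
Implicit Types (f phi psi : plane -> C) (T : functional R).

Lemma complexReM (x y : C) : complex.Re (x * y)
  = complex.Re x * complex.Re y - complex.Im x * complex.Im y.
Proof. by case: x y => [a b] [c d]. Qed.

Lemma complexImM (x y : C) : complex.Im (x * y)
  = complex.Re x * complex.Im y + complex.Im x * complex.Re y.
Proof. by case: x y => [a b] [c d]. Qed.

Lemma smooth_cst (c : C) : smooth (fun=> c).
Proof. by move=> n; split; exact: Cn_cst. Qed.

Lemma smooth_real (g : plane -> R) : (forall n, Cn n g) ->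
  smooth (fun q => (g q)%:C).
Proof. by move=> gC n; split=> //; exact: Cn_cst. Qed.

Lemma smoothD f phi : smooth f -> smooth phi ->
  smooth (fun q => f q + phi q).
Proof.
move=> Sf Sphi n; split.
  rewrite (_ : (fun q => _) = fun q => complex.Re (f q) + complex.Re (phi q)).
    by apply: CnD; [have [] := Sf n|have [] := Sphi n].
  by apply/funext => q; case: (f q) (phi q) => [a b] [c d].
rewrite (_ : (fun q => _) = fun q => complex.Im (f q) + complex.Im (phi q)).
  by apply: CnD; [have [] := Sf n|have [] := Sphi n].
by apply/funext => q; case: (f q) (phi q) => [a b] [c d].
Qed.

Lemma smoothM f phi : smooth f -> smooth phi ->
  smooth (fun q => f q * phi q).
Proof.
move=> Sf Sphi n; have [R1 I1] := Sf n; have [R2 I2] := Sphi n; split.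
  under eq_fun do rewrite complexReM.
  by apply: CnB; exact: CnM.
under eq_fun do rewrite complexImM.
by apply: CnD; exact: CnM.
Qed.

Lemma smoothX f k : smooth f -> smooth (fun q => f q ^+ k).
Proof.
move=> Sf; elim: k => [|k IHk]; first exact: (smooth_cst 1).
by under eq_fun do rewrite exprS; exact: smoothM.
Qed.

Lemma fsupp_sub f (F : set plane) :
  closed F -> (forall q, f q != 0 -> F q) -> fsupp f `<=` F.
Proof.
by move=> cF fF; rewrite [X in _ `<=` X](closure_id F).1//; exact: closure_subset.
Qed.

Lemma fsupp_mem f q : f q != 0 -> fsupp f q.
Proof. by move=> fq; apply: subset_closure. Qed.

Lemma fsuppM f phi : fsupp (fun q => f q * phi q) `<=` fsupp phi.
Proof.
apply: fsupp_sub; first exact: closed_closure.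
by move=> q; rewrite mulf_eq0 negb_or => /andP[_]; exact: fsupp_mem.
Qed.

Lemma test_functionM f phi : smooth f -> test_function phi ->
  test_function (fun q => f q * phi q).
Proof.
move=> Sf [Sphi Kphi]; split; first exact: smoothM.
by apply: subclosed_compact Kphi (@fsuppM _ _); exact: closed_closure.
Qed.

Lemma test_function_lin (a : C) phi psi :
  test_function phi -> test_function psi ->
  test_function (fun q => a * phi q + psi q).
Proof.
move=> [Sphi Kphi] [Spsi Kpsi]; split.
  by apply: smoothD => //; apply: smoothM => //; exact: smooth_cst.
apply: (subclosed_compact _ (compactU Kphi Kpsi)); first exact: closed_closure.
apply: fsupp_sub; first by apply: closedU; exact: closed_closure.
move=> q; apply: contra_neqP => /not_orP[phi0 psi0].
have -> : phi q = 0 by apply: contra_notP phi0 => /eqP; exact: fsupp_mem.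
have -> : psi q = 0 by apply: contra_notP psi0 => /eqP; exact: fsupp_mem.
by rewrite mulr0 addr0.
Qed.

Lemma test_function0 : test_function (fun=> 0 : C).
Proof.
split; first exact: smooth_cst.
rewrite /fsupp (_ : [set q | _] = set0) ?closure0; first exact: compact0.
by apply/seteqP; split=> // q /=; rewrite eqxx.
Qed.

Lemma distribution0 T : Defs.distribution T -> T (fun=> 0) = 0.
Proof.
move=> [TL _]; have := TL (-1) _ _ test_function0 test_function0.
under eq_fun do rewrite mulr0 addr0.
by rewrite mulN1r addNr.
Qed.

Definition sqdist (c q : plane) : R := (q.1 - c.1) ^+ 2 + (q.2 - c.2) ^+ 2.

Lemma Cn_sqdist n c : Cn n (sqdist c).
Proof.
by apply: CnD; apply: CnX; apply: CnB;
  [exact: Cn_fst|exact: Cn_cst|exact: Cn_snd|exact: Cn_cst].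
Qed.

Lemma sqdist_cont c : continuous (sqdist c).
Proof. exact: Cn_cont (Cn_sqdist 0 c). Qed.

Lemma sqdist_closed c r : closed [set q | sqdist c q <= r].
Proof.
have -> : [set q | sqdist c q <= r] = sqdist c @^-1` [set x | x <= r] by [].
apply: closed_comp; last exact: closed_le.
by move=> q _; exact: sqdist_cont.
Qed.

Lemma sqdist_open c r : open [set q | sqdist c q < r].
Proof.
have -> : [set q | sqdist c q < r] = sqdist c @^-1` [set x | x < r] by [].
apply: open_comp; last exact: open_lt.
by move=> q _; exact: sqdist_cont.
Qed.

Lemma sqdistxx c : sqdist c c = 0.
Proof. by rewrite /sqdist !subrr expr0n addr0. Qed.

Lemma sqdist_nbhs (U : set plane) c : open U -> U c ->
  exists2 r, 0 < r & forall q, sqdist c q <= r -> U q.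
Proof.
move=> oU Uc; have /nbhs_ballP[e /= e0 eU] : nbhs c U by exact: open_nbhs_nbhs.
have e20 : 0 < e / 2 by rewrite divr_gt0.
exists ((e / 2) ^+ 2); first by rewrite exprn_gt0.
move=> q qe; apply: eU.
have bound (x : R) : x ^+ 2 <= (e / 2) ^+ 2 -> `|x| < e.
  move=> xe; rewrite -ltr_sqr ?nnegrE ?(ltW e0)// real_normK ?num_real//.
  by apply: le_lt_trans xe _; nra.
split; rewrite /ball /= distrC; apply: bound; apply: le_trans qe;
  rewrite /sqdist.
  by rewrite lerDl sqr_ge0.
by rewrite lerDr sqr_ge0.
Qed.

Lemma plane_cover (A : set plane) : compact A -> @cover_compact plane A.
Proof.
(* the covering characterization of compactness is stated for pointed spaces *)
pose pplane : ptopologicalType :=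
  HB.pack plane (Pointed.on plane) (Topological.on plane).
by move=> cA; rewrite -(@compact_cover pplane).
Qed.

(** The support is defined pointwise, so phi has to be cut into small pieces.
    By compactness there are finitely many plateaus b_i, each supported in a
    disc on which T vanishes, such that every point of the support of phi has
    some b_i equal to 1.  Then phi * prod_i (1 - b_i) = 0, while each factor
    1 - b_i only changes the function by a multiple of b_i, which T does not
    see. *)
Lemma distribution_vanish T phi : Defs.distribution T -> test_function phi ->
  (forall q, fsupp phi q -> ~ dsupp T q) -> T phi = 0.
Proof.
move=> dT tphi disj; have [TL _] := dT.
have [rad radP] : exists rad : plane -> R, forall c, fsupp phi c ->
    0 < rad c /\ forall psi, test_function psi ->
      (forall q, psi q != 0 -> sqdist c q <= rad c) -> T psi = 0.
  suff /choice[rad radP] : forall c, exists r : R, fsupp phi c ->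
    0 < r /\ forall psi, test_function psi ->
      (forall q, psi q != 0 -> sqdist c q <= r) -> T psi = 0 by exists rad.
  move=> c; have [sc|] := pselect (fsupp phi c); last by exists 0.
  have /existsNP[U /not_implyP[oU /not_implyP[Uc TU]]] := disj c sc.
  have [r r0 rU] := sqdist_nbhs oU Uc.
  exists r => _; split=> // psi tpsi psir; apply: contra_notP TU => Tpsi.
  exists psi; split=> // q /(fsupp_sub (@sqdist_closed c r) psir).
  exact: rU.
pose b c q : R := plateau (rad c / 2) (rad c) (sqdist c q).
have [_ Kphi] := tphi.
move: Kphi => /plane_cover /(_ plane (fsupp phi)
  (fun c => [set q | sqdist c q < rad c / 2])) [].
- by move=> c _; exact: sqdist_open.
- move=> c sc; exists c => //=; rewrite sqdistxx.
  by have [r0 _] := radP c sc; rewrite divr_gt0.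
move=> D Dsub Dcov.
have [s0 s0sub s0cov] : exists2 s0 : seq plane,
    (forall c, c \in s0 -> fsupp phi c) &
    forall q, fsupp phi q -> exists2 c, c \in s0 & sqdist c q < rad c / 2.
  exists (finmap.enum_fset D) => [c cD|q sq]; first exact/set_mem/Dsub.
  by have [c /= cD qc] := Dcov q sq; exists c.
pose cut (s : seq plane) : plane -> C :=
  fun q => \prod_(c <- s) (1 - (b c q)%:C) * phi q.
have sb c : smooth (fun q => (b c q)%:C).
  by apply: smooth_real => n; apply: Cn_plateau; exact: Cn_sqdist.
have tcut s : test_function (cut s).
  apply: test_functionM => //; elim: s => [|c s IHs].
    by under eq_fun do rewrite big_nil; exact: smooth_cst.
  under eq_fun do rewrite big_cons.
  apply: smoothM => //; under eq_fun do rewrite -mulN1r.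
  apply: smoothD; first exact: smooth_cst.
  by apply: smoothM => //; exact: smooth_cst.
have Tcut s : {subset s <= s0} -> T (cut s) = T phi.
  elim: s => [|c s IHs] sD.
    by rewrite /cut; under eq_fun do rewrite big_nil mul1r.
  have sc : fsupp phi c by apply/s0sub/sD; rewrite mem_head.
  have [r0 Tc] := radP c sc.
  have -> : cut (c :: s)
      = fun q => (-1) * ((b c q)%:C * cut s q) + cut s q.
    by apply/funext => q; rewrite /cut big_cons; ring.
  rewrite TL//; last exact: test_functionM.
  rewrite Tc ?mulr0 ?add0r; first 1 last.
  - exact: test_functionM.
  - move=> q; rewrite mulf_eq0 negb_or => /andP[bq _].
    rewrite leNgt; apply: contra_neqN bq => /ltW rq.
    by rewrite /b plateau_out// gtr_pMr// invf_lt1// ltr1n.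
  by apply: IHs => x xs; apply: sD; rewrite in_cons xs orbT.
rewrite -(Tcut s0) // -[RHS](distribution0 dT); congr T; apply/funext => q.
rewrite /cut; have [->|phiq] := eqVneq (phi q) 0; first by rewrite mulr0.
have [c cs qc] := s0cov q (fsupp_mem phiq).
apply/eqP; rewrite mulf_eq0; apply/orP; left.
rewrite prodf_seq_eq0; apply/hasP; exists c => //=.
by rewrite /b plateau_in ?subrr//; exact: ltW.
Qed.

Definition agrees_near (K : set plane) (f g : plane -> C) : Prop :=
  forall q, K q -> \forall q' \near q, f q' = g q'.

Definition smooth_near (K : set plane) f : Prop :=
  exists2 phi, test_function phi & agrees_near K phi f.

(** Two test functions that coincide with f near the support differ by one whose
    support misses that of T. *)
Lemma pairingE T f phi : Defs.distribution T -> test_function phi ->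
  agrees_near (dsupp T) phi f -> pairing T f = T phi.
Proof.
move=> dT tphi phif; rewrite /pairing; case: xgetP => [y -> [psi [tpsi psif] <-]|].
  have tdiff := test_function_lin (-1) tphi tpsi.
  have : T (fun q => (-1) * phi q + psi q) = 0.
    apply: distribution_vanish => // q sq Tq.
    have /sq[q' [/= /eqP q'0 E]] : nbhs q [set q' | phi q' = psi q'].
      near=> q' => /=; transitivity (f q'); near: q'; first exact: phif.
      by apply: filterS (psif q Tq) => ? ->.
    by apply: q'0; rewrite E mulN1r addNr.
  by case: dT => TL _; rewrite TL// mulN1r addrC => /eqP; rewrite subr_eq0 => /eqP.
move=> /(_ (T phi)) []; exists phi => //; split=> //.
Unshelve. all: by end_near.
Qed.

Lemma pairing_eq T f g : agrees_near (dsupp T) f g ->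
  pairing T f = pairing T g.
Proof.
move=> fg; rewrite /pairing; congr (xget 0 (_ @` _)); apply/seteqP.
split=> phi [tphi H]; split=> // q Tq; near=> q'.
  by transitivity (f q'); near: q'; [exact: H|exact: fg].
transitivity (g q'); near: q'; first exact: H.
by apply: filterS (fg q Tq) => ? ->.
Unshelve. all: by end_near.
Qed.

Lemma smooth_near_lin K (a : C) f g : smooth_near K f -> smooth_near K g ->
  smooth_near K (fun q => a * f q + g q).
Proof.
move=> [phi tphi phif] [psi tpsi psig].
exists (fun q => a * phi q + psi q); first exact: test_function_lin.
move=> q Kq; near=> q'; congr (_ * _ + _); near: q'; first exact: phif.
exact: psig.
Unshelve. all: by end_near.
Qed.

Lemma smooth_near0 K : smooth_near K (fun=> 0).
Proof.
exists (fun=> 0); first exact: test_function0.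
by move=> q _; apply: filterE.
Qed.

Lemma smooth_nearM K f g : smooth_near K f -> smooth_near K g ->
  smooth_near K (fun q => f q * g q).
Proof.
move=> [phi [Sphi _] phif] [psi tpsi psig].
exists (fun q => phi q * psi q); first exact: test_functionM.
move=> q Kq; near=> q'; congr (_ * _); near: q'; first exact: phif.
exact: psig.
Unshelve. all: by end_near.
Qed.

Lemma smooth_near_eq K f g : agrees_near K f g ->
  smooth_near K f -> smooth_near K g.
Proof.
move=> fg [phi tphi phif]; exists phi => // q Kq; near=> q'.
by transitivity (f q'); near: q'; [exact: phif|exact: fg].
Unshelve. all: by end_near.
Qed.

Lemma pairing_lin T (a : C) f g : Defs.distribution T ->
  smooth_near (dsupp T) f -> smooth_near (dsupp T) g ->
  pairing T (fun q => a * f q + g q) = a * pairing T f + pairing T g.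
Proof.
move=> dT [phi tphi phif] [psi tpsi psig].
rewrite (pairingE dT tphi phif) (pairingE dT tpsi psig).
have [TL _] := dT; rewrite -TL//.
apply: pairingE => //; first exact: test_function_lin.
move=> q Kq; near=> q'; congr (_ * _ + _); near: q'; first exact: phif.
exact: psig.
Unshelve. all: by end_near.
Qed.

Lemma pairing0 T : Defs.distribution T -> pairing T (fun=> 0) = 0.
Proof.
move=> dT; rewrite (pairingE dT test_function0) ?distribution0//.
by move=> q _; apply: filterE.
Qed.

Lemma pairing_sum T (I : Type) (r : seq I) (a : I -> C) (f : I -> plane -> C) :
  Defs.distribution T -> (forall i, smooth_near (dsupp T) (f i)) ->
  pairing T (fun q => \sum_(i <- r) a i * f i q)
    = \sum_(i <- r) a i * pairing T (f i).
Proof.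
move=> dT sf.
have [] : smooth_near (dsupp T) (fun q => \sum_(i <- r) a i * f i q) /\
  pairing T (fun q => \sum_(i <- r) a i * f i q)
    = \sum_(i <- r) a i * pairing T (f i); last by [].
elim: r => [|i r [IHs IHp]].
  rewrite big_nil; under eq_fun do rewrite big_nil.
  by split; [exact: smooth_near0|exact: pairing0].
rewrite big_cons -IHp; under eq_fun do rewrite big_cons.
by split; [exact: smooth_near_lin|exact: pairing_lin].
Qed.

(** The cut-off is a plateau in the squared distance to the origin. *)
Lemma smooth_smooth_near K f (r : R) :
  (forall q, K q -> `|q.1| <= r /\ `|q.2| <= r) ->
  smooth f -> smooth_near K f.
Proof.
move=> Kr Sf.
pose a := r ^+ 2 + r ^+ 2 + 1.
pose b (q : plane) : R := plateau a (a + 1) (sqdist 0 q).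
have sqr (x : R) : `|x| <= r -> x ^+ 2 <= r ^+ 2.
  move=> xr; rewrite -[x ^+ 2]real_normK ?num_real// lerXn2r// nnegrE//.
  by rewrite (le_trans _ xr).
exists (fun q => f q * (b q)%:C).
  apply: test_functionM => //; split.
    by apply: smooth_real => n; apply: Cn_plateau; exact: Cn_sqdist.
  apply: (@subclosed_compact _ _ (`[- (a + 1), a + 1] `*` `[- (a + 1), a + 1])).
  - exact: closed_closure.
  - by apply: compact_setX; exact: segment_compact.
  apply: (@subset_trans _ [set q | sqdist 0 q <= a + 1]).
    apply: fsupp_sub; first exact: sqdist_closed.
    move=> q; apply: contra_neqT; rewrite -ltNge => /ltW aq.
    by rewrite /b plateau_out// ltrDl.
  move=> q; rewrite /sqdist /= !subr0 => qa.
  have a1 : 1 <= a + 1 by rewrite /a; nra.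
  have bound (x : R) : x ^+ 2 <= a + 1 -> - (a + 1) <= x <= a + 1.
    by move=> xa; apply/andP; split; nra.
  by split; rewrite /= in_itv /=; apply: bound; nra.
move=> q Kq; have [q1 q2] := Kr q Kq.
have : nbhs q [set q' | sqdist 0 q' < a].
  apply: open_nbhs_nbhs; split; first exact: sqdist_open.
  by rewrite /sqdist /= !subr0 /a; have := sqr _ q1; have := sqr _ q2; lra.
apply: filterS => q' /ltW qa.
by rewrite /b plateau_in// mulr1.
Qed.

End Distributions.

(** * The exponential of a Miwa shift *)

Section MiwaExponential.
Variable R : realType.
Local Notation C := R[i].
Implicit Types (a : nat -> C).

Lemma cexpD (v w : C) : cexp (v + w) = cexp v * cexp w.
Proof.
case: v w => [a b] [c d]; rewrite /cexp /= expRD cosD sinD.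
by apply/eqP; rewrite eq_complex /=; apply/andP; split; apply/eqP; ring.
Qed.

Lemma cexp0 : cexp 0 = 1 :> C.
Proof.
rewrite /cexp /= expR0 cos0 sin0.
by apply/eqP; rewrite eq_complex /=; apply/andP; split; apply/eqP; ring.
Qed.

Lemma cexp_unit (w : C) : cexp w != 0.
Proof.
apply/eqP => w0; have := cexpD w (- w).
by rewrite subrr cexp0 w0 mul0r => /eqP; rewrite oner_eq0.
Qed.

Lemma cexpN (w : C) : cexp (- w) = (cexp w)^-1.
Proof.
apply: (mulfI (cexp_unit w)); rewrite -cexpD subrr cexp0 mulfV//.
exact: cexp_unit.
Qed.

Lemma complexReD (x y : C) : complex.Re (x + y) = complex.Re x + complex.Re y.
Proof. by case: x y => [a b] [c d]. Qed.

Lemma complexImD (x y : C) : complex.Im (x + y) = complex.Im x + complex.Im y.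
Proof. by case: x y => [a b] [c d]. Qed.

Lemma complexReMr (x : C) (c : R) : complex.Re (x * c%:C) = complex.Re x * c.
Proof. by case: x => [a b] /=; rewrite mulr0 subr0. Qed.

Lemma complexImMr (x : C) (c : R) : complex.Im (x * c%:C) = complex.Im x * c.
Proof. by case: x => [a b] /=; rewrite mulr0 add0r. Qed.

Definition tsum a (x : R) : nat -> C :=
  fun n => \sum_(1 <= j < n) a j * x%:C ^+ j.

Definition tseries_cvg a (x : R) (l : C) : Prop :=
  (fun n => complex.Re (tsum a x n)) @ \oo --> complex.Re l /\
  (fun n => complex.Im (tsum a x n)) @ \oo --> complex.Im l.

Lemma tseries_cvgE a x l : tseries_cvg a x l -> tseries a x%:C = l.
Proof.
move=> [cRe cIm]; rewrite /tseries.
rewrite (cvg_lim (@Rhausdorff R) cRe) (cvg_lim (@Rhausdorff R) cIm).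
by case: l {cRe cIm}.
Qed.

Lemma tseries_cvgD a b x l m : tseries_cvg a x l -> tseries_cvg b x m ->
  tseries_cvg (fun j => a j + b j) x (l + m).
Proof.
move=> [cl1 cl2] [cm1 cm2].
have E n : tsum (fun j => a j + b j) x n = tsum a x n + tsum b x n.
  by rewrite /tsum -big_split /=; apply: eq_bigr => j _; rewrite mulrDl.
split.
  under eq_fun do rewrite E complexReD; rewrite complexReD; exact: cvgD.
under eq_fun do rewrite E complexImD; rewrite complexImD; exact: cvgD.
Qed.

Lemma tseries_cvgN a x l : tseries_cvg a x l ->
  tseries_cvg (fun j => - a j) x (- l).
Proof.
move=> [cl1 cl2].
have E n : tsum (fun j => - a j) x n = - tsum a x n.
  by rewrite /tsum -sumrN; apply: eq_bigr => j _; rewrite mulNr.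
have ReN (y : C) : complex.Re (- y) = - complex.Re y by case: y.
have ImN (y : C) : complex.Im (- y) = - complex.Im y by case: y.
split.
  under eq_fun do rewrite E ReN; rewrite ReN; exact: cvgN.
under eq_fun do rewrite E ImN; rewrite ImN; exact: cvgN.
Qed.

Lemma tseries_cvg_finite a N x : (forall j, (N <= j)%N -> a j = 0) ->
  tseries_cvg a x (tsum a x N).
Proof.
move=> aN.
have E n : (N <= n)%N -> tsum a x n = tsum a x N.
  move=> Nn; rewrite /tsum; have [N1|N1] := leqP 1 N.
    rewrite (big_cat_nat N1 Nn) /= [X in _ + X = _]big1_seq ?addr0// => j.
    by rewrite mem_index_iota => /andP[_ /andP[Nj _]]; rewrite aN// mul0r.
  rewrite [RHS]big_geq 1?ltnW// big1// => j _.
  by rewrite aN ?mul0r//; move: N1; rewrite ltnS leqn0 => /eqP ->.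
by split; apply: cvg_near_cst; exists N => // n /= Nn; rewrite E.
Qed.

Variable z : C.
Let rho : R := normc z.
Hypothesis rho0 : 0 < rho.
Let w : C := z^-1.

(** Two terms of the binomial expansion of (r + d)^(j+1).  With r + d < 1 it
    shows that a linear factor does not spoil geometric convergence. *)
Lemma linear_le_geometric (r d : R) j : 0 <= r -> 0 <= d ->
  j.+1%:R * r ^+ j * d <= (r + d) ^+ j.+1.
Proof.
move=> r0 d0.
suff : r ^+ j.+1 + j.+1%:R * r ^+ j * d <= (r + d) ^+ j.+1.
  by apply: le_trans; rewrite lerDr exprn_ge0.
elim: j => [|j IHj]; first by rewrite expr0 !expr1 !mul1r.
rewrite [leRHS]exprS; apply: le_trans (ler_wpM2l _ IHj); last exact: addr_ge0.
have p0 : 0 <= r ^+ j by exact: exprn_ge0.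
have n0 : 0 <= j.+1%:R :> R by [].
rewrite -[j.+2%:R]natr1 !exprS.
have H : 0 <= d * (j.+1%:R * r ^+ j * d) by rewrite !mulr_ge0.
by move: H; set P := r ^+ j; set n := j.+1%:R; nra.
Qed.

Lemma pseries_cvg_linear (c : nat -> R) (B K : R) : 0 <= K -> K < rho ->
  (forall j, `|c j| <= B * j.+1%:R * rho^-1 ^+ j) -> cvgn (pseries c K).
Proof.
move=> K0 Krho cB.
pose r := K / rho; pose d := (1 - r) / 2.
have r0 : 0 <= r by rewrite divr_ge0// ltW.
have r1 : r < 1 by rewrite ltr_pdivrMr// mul1r.
have d0 : 0 < d by rewrite divr_gt0// subr_gt0.
have B0 : 0 <= B.
  by have := cB 0%N; rewrite expr0 !mulr1; apply: le_trans.
have rd0 : 0 <= r + d by rewrite addr_ge0// ltW.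
apply: normed_cvg.
apply: (@series_le_cvg _ _ (geometric (B * (r + d) / d) (r + d))).
- by move=> n /=.
- by move=> n; apply: mulr_ge0; [apply: divr_ge0; [exact: mulr_ge0|exact: ltW]|
    exact: exprn_ge0].
- move=> n; rewrite /= normrM normrX (ger0_norm K0).
  apply: le_trans (ler_wpM2r (exprn_ge0 _ K0) (cB n)) _.
  have -> : B * n.+1%:R * rho^-1 ^+ n * K ^+ n = B * (n.+1%:R * r ^+ n).
    by rewrite /r exprMn; ring.
  have := linear_le_geometric n r0 (ltW d0); rewrite -ler_pdivlMr// => H.
  apply: le_trans (ler_wpM2l B0 H) _.
  by rewrite exprS le_eqVlt; apply/orP; left; apply/eqP; ring.
- apply: is_cvg_geometric_series; rewrite ger0_norm ?addr_ge0// ?ltW//.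
  by rewrite /d; lra.
Qed.

Lemma normc_Re_le (x : C) : `|complex.Re x| <= normc x.
Proof. by have := normc_ge_Re x; rewrite lecR. Qed.

Lemma normc_Im_le (x : C) : `|complex.Im x| <= normc x.
Proof.
case: x => a b /=; rewrite -sqrtr_sqr; apply: ler_wsqrtr.
by rewrite lerDr sqr_ge0.
Qed.

Lemma normc_ge0 (x : C) : 0 <= normc x.
Proof. by apply: le_trans (normc_Re_le x). Qed.

Lemma normcX (x : C) n : normc (x ^+ n) = normc x ^+ n.
Proof.
elim: n => [|n IHn]; first by rewrite !expr0 normc1.
by rewrite !exprS normcM IHn.
Qed.

Lemma miwaE j : miwa z j = w ^+ j * (j%:R^-1)%:C.
Proof.
rewrite /miwa invfM exprVn mulrC; congr (_ * _).
by rewrite -(rmorph_nat (real_complex R)) -fmorphV.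
Qed.

(* part stands for Re or Im, as complex series are taken componentwise *)
Variable part : C -> R.
Hypothesis partD : forall x y : C, part (x + y) = part x + part y.
Hypothesis partM : forall (x : C) (c : R), part (x * c%:C) = part x * c.
Hypothesis part_le : forall x : C, `|part x| <= normc x.

Let c j := part (miwa z j).

Lemma part0 : part 0 = 0.
Proof. by apply/eqP; rewrite -normr_le0 (le_trans (part_le _))// normc0. Qed.

Lemma miwa_diffs j : pseries_diffs c j = part (w ^+ j.+1).
Proof. by rewrite /pseries_diffs /c miwaE partM mulrC mulfVK. Qed.

Lemma part_wX j : `|part (w ^+ j)| <= rho^-1 ^+ j.
Proof. by apply: le_trans (part_le _) _; rewrite normcX normcV. Qed.

Lemma tsum_pseries x n : part (tsum (miwa z) x n) = pseries c x n.
Proof.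
rewrite /tsum /pseries /series /= (big_morph _ partD part0).
have m0 : miwa z 0 = 0 by rewrite /miwa mul0r invr0.
case: n => [|n]; first by rewrite !big_geq.
rewrite [RHS]big_ltn// {1}/c m0 part0 mul0r add0r.
by apply: eq_bigr => j _; rewrite -rmorphXn partM.
Qed.

Lemma miwa_ratio_lt1 (x : R) : `|x| < rho -> normc (w * x%:C) < 1.
Proof.
move=> xrho; rewrite normcM normcV /= expr0n addr0 sqrtr_sqr mulrC.
by rewrite ltr_pdivrMr ?mul1r.
Qed.

Lemma miwa_ratio_neq1 (x : R) : `|x| < rho -> 1 - w * x%:C != 0.
Proof.
move=> /miwa_ratio_lt1 nv; rewrite subr_eq0.
by apply: contraTneq nv => <-; rewrite normc1 ltxx.
Qed.

Lemma geometric_cvg x : `|x| < rho ->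
  pseries (fun j => part (w ^+ j.+1)) x @ \oo --> part (w / (1 - w * x%:C)).
Proof.
move=> xrho; pose v := w * x%:C; set g := w / (1 - v).
have nv : normc v < 1 by exact: miwa_ratio_lt1.
have v1 : 1 - v != 0 by exact: miwa_ratio_neq1.
have E n : pseries (fun j => part (w ^+ j.+1)) x n
    = part g + part (- (g * v ^+ n)).
  rewrite -partD /pseries /series /=.
  rewrite (_ : g + _ = \sum_(0 <= j < n) w ^+ j.+1 * (x ^+ j)%:C).
    by rewrite (big_morph _ partD part0); apply: eq_bigr => j _; rewrite partM.
  elim: n => [|n IHn]; first by rewrite big_geq// expr0 mulr1 subrr.
  rewrite big_nat_recr//= -IHn rmorphXn /= exprSr [w ^+ n.+1]exprSr.
  rewrite [w ^+ n * w * _]mulrAC -exprMn -/v.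
  have -> : w = g * (1 - v) by rewrite /g mulfVK.
  by ring.
rewrite -[X in _ --> X]addr0 (funext E).
apply: cvgD; first exact: cvg_cst.
apply/norm_cvg0P/(@squeeze_cvgr _ _ _ _ (cst 0) (geometric (normc g) (normc v))).
- apply: nearW => n; rewrite normr_ge0 /=; apply: le_trans (part_le _) _.
  by rewrite normcN normcM normcX.
- exact: cvg_cst.
- apply: cvg_geometric; by rewrite ger0_norm// normc_ge0.
Qed.

(** Term by term, the derivative of sum_j w^j x^j / j is the geometric series
    sum_j w^(j+1) x^j = w / (1 - w x). *)
Lemma miwa_is_derive (x : R) : `|x| < rho ->
  is_derive x 1 (fun y => limn (pseries c y)) (part (w / (1 - w * x%:C))) /\
  pseries c x @ \oo --> limn (pseries c x).
Proof.
move=> xrho.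
(* a point strictly between x and the circle of convergence *)
pose K := (`|x| + rho) / 2.
have xK : `|x| < K by rewrite /K; lra.
have K0 : 0 <= K by exact: le_trans (ltW xK).
have Krho : K < rho by rewrite /K; lra.
have nrho j : 0 <= rho^-1 ^+ j by rewrite exprn_ge0// invr_ge0 ltW.
have dE : pseries_diffs c = fun j => part (w ^+ j.+1).
  by apply/funext => j; exact: miwa_diffs.
have C0 : cvgn (pseries c K).
  apply: (@pseries_cvg_linear _ 1) => // j; rewrite mul1r.
  rewrite /c miwaE partM normrM.
  apply: (@le_trans _ _ (`|part (w ^+ j)| * 1)).
    apply: ler_wpM2l => //; case: j => [|j]; first by rewrite invr0 normr0.
    by rewrite ger0_norm ?invr_ge0// invf_le1// ler1n.
  by rewrite mulr1 (le_trans (part_wX j))// ler_peMl// ler1n.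
have C1 : cvgn (pseries (pseries_diffs c) K).
  apply: (@pseries_cvg_linear _ rho^-1) => // j; rewrite miwa_diffs.
  apply: le_trans (part_wX _) _; rewrite exprS mulrAC ler_peMr ?ler1n//.
  by rewrite mulr_ge0// invr_ge0 ltW.
have C2 : cvgn (pseries (pseries_diffs (pseries_diffs c)) K).
  apply: (@pseries_cvg_linear _ (rho^-1 ^+ 2)) => // j.
  rewrite [pseries_diffs _ _]/pseries_diffs miwa_diffs normrM ger0_norm//.
  rewrite [leRHS]mulrAC -exprD mulrC; apply: ler_wpM2r => //.
  by rewrite addnC addn2; exact: part_wX.
have xK' : `|x| < `|K| by rewrite (ger0_norm K0).
split; last exact: is_cvg_pseries_inside C0 xK'.
have := pseries_snd_diffs C0 C1 C2 xK'.
rewrite dE (cvg_lim (@Rhausdorff R) (geometric_cvg xrho)).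
exact.
Qed.

Lemma miwa_limn0 : limn (pseries c 0) = 0.
Proof.
apply: (cvg_lim (@Rhausdorff R)); apply: cvg_near_cst; apply: nearW => n.
rewrite -tsum_pseries /tsum big_nat_cond big1 ?part0// => j /andP[/andP[j0 _] _].
by rewrite expr0n gtn_eqF// mulr0.
Qed.

End MiwaExponential.

Section Evolution.
Variable R : realType.
Local Notation C := R[i].
Local Notation plane := (R * R)%type.

Section MiwaSum.
Variable z : C.
Hypothesis z0 : 0 < normc z.
Let w : C := z^-1.

Definition miwa_sum (x : R) : C :=
  limn (pseries (fun j => complex.Re (miwa z j)) x)
    +i* limn (pseries (fun j => complex.Im (miwa z j)) x).

Let ReP (x : R) := @miwa_is_derive R z z0 (@complex.Re R)
  (@complexReD R) (@complexReMr R)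
  (@normc_Re_le R) x.
Let ImP (x : R) := @miwa_is_derive R z z0 (@complex.Im R)
  (@complexImD R) (@complexImMr R)
  (@normc_Im_le R) x.

Lemma miwa_sum_cvg (x : R) : `|x| < normc z ->
  tseries_cvg (miwa z) x (miwa_sum x).
Proof.
move=> xz; split.
  under eq_fun do rewrite (tsum_pseries _ (@complexReD R) (@complexReMr R)
    (@normc_Re_le R)).
  exact: (ReP xz).2.
under eq_fun do rewrite (tsum_pseries _ (@complexImD R) (@complexImMr R)
  (@normc_Im_le R)).
exact: (ImP xz).2.
Qed.

Lemma miwa_sum0 : miwa_sum 0 = 0.
Proof.
rewrite /miwa_sum (miwa_limn0 z (@complexReD R) (@complexReMr R) (@normc_Re_le R)).
by rewrite (miwa_limn0 z (@complexImD R) (@complexImMr R) (@normc_Im_le R)).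
Qed.

Lemma eq_from_derive0 (f : R -> R) (r x : R) :
  (forall y : R, `|y| < r -> is_derive y 1 f 0) -> `|x| < r -> f x = f 0.
Proof.
move=> Df xr.
suff H a b : `|a| < r -> `|b| < r -> a <= b -> f b = f a.
  have r0 : `|0 : R| < r by rewrite normr0 (le_lt_trans _ xr).
  by have [x0|x0] := leP x 0; [rewrite (H x 0)|rewrite (H 0 x)// ltW].
move=> ar br ab.
have inr y : y \in `[a, b]%R -> `|y| < r.
  rewrite in_itv /= => /andP[ay yb]; move: ar br; rewrite !ltr_norml.
  by move=> /andP[? ?] /andP[? ?]; apply/andP; split; lra.
have [||c _] := MVT_segment ab (f := f) (df := fun=> 0).
- move=> y /subset_itv_oo_cc yab; by apply/Df/inr.
- by apply: derivable_within_continuous => u /inr /Df [].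
- by rewrite mul0r => /eqP; rewrite subr_eq0 => /eqP.
Qed.

(** Both sides agree at 0.  With L the sum of the Miwa series, L'(x) = 1/(z - x),
    so the left-hand side has zero derivative; u + iv below is 1 - x/z.  No
    complex logarithm is involved. *)
Lemma cexp_miwa_sum (x : R) : `|x| < normc z ->
  cexp (miwa_sum x) * (1 - x%:C / z) = 1.
Proof.
move=> xz; rewrite mulrC [x%:C / z]mulrC -/w mulrC.
pose F (y : R) : C := cexp (miwa_sum y) * (1 - w * y%:C).
have F0 : F 0 = 1 by rewrite /F miwa_sum0 cexp0 mulr0 subr0 mulr1.
rewrite -/(F x) -F0.
pose a (y : R) := complex.Re (miwa_sum y).
pose b (y : R) := complex.Im (miwa_sum y).
pose wr := complex.Re w; pose wi := complex.Im w.
pose u (y : R) : R := 1 - wr * y; pose v (y : R) : R := - (wi * y).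
pose FR (s : R) := complex.Re (F s).
pose FI (s : R) := complex.Im (F s).
have FRe (y : R) : complex.Re (F y)
    = expR (a y) * (cos (b y) * u y - sin (b y) * v y).
  by rewrite /F /cexp /a /b /u /v /wr /wi; case: w => p q;
    case: (miwa_sum y) => k l /=; ring.
have FIm (y : R) : complex.Im (F y)
    = expR (a y) * (cos (b y) * v y + sin (b y) * u y).
  by rewrite /F /cexp /a /b /u /v /wr /wi; case: w => p q;
    case: (miwa_sum y) => k l /=; ring.
have D (y : R) : `|y| < normc z -> is_derive y 1 (FR) 0 /\
    is_derive y 1 (FI) 0.
  move=> yz.
  pose g := w / (1 - w * y%:C).
  have Da : is_derive y 1 a (complex.Re g) := (ReP yz).1.
  have Db : is_derive y 1 b (complex.Im g) := (ImP yz).1.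
  have y1 : 1 - w * y%:C != 0 by exact: miwa_ratio_neq1.
  have gE : g * (1 - w * y%:C) = w by rewrite /g mulfVK.
  have gr : complex.Re g * u y - complex.Im g * v y = wr.
    by rewrite /wr -[in RHS]gE /u /v /wr /wi; case: (g) => p q;
      case: (w) => k l /=; ring.
  have gi : complex.Re g * v y + complex.Im g * u y = wi.
    by rewrite /wi -[in RHS]gE /u /v /wr /wi; case: (g) => p q;
      case: (w) => k l /=; ring.
  have D1 (k : R) : is_derive y 1 (fun s : R => k * s) k.
    apply: (is_derive_eq (is_deriveM (is_derive_cst k y 1) (is_derive_id y 1))).
    by rewrite scaler0 addr0 /GRing.scale /= mulr1.
  have Du : is_derive y 1 u (- wr).
    apply: (is_derive_eq (is_deriveB (is_derive_cst (1 : R) y 1) (D1 wr))).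
    by rewrite sub0r.
  have Dv : is_derive y 1 v (- wi) := is_deriveN (D1 wi).
  have De := is_derive1_comp (is_derive_expR (a y)) Da.
  have Dc := is_derive1_comp (is_derive_cos (b y)) Db.
  have Ds := is_derive1_comp (is_derive_sin (b y)) Db.
  split.
    rewrite (_ : FR = (@expR R \o a)
        * ((@cos R \o b) * u - (@sin R \o b) * v)); last first.
      by apply/funext => s; exact: FRe.
    apply: (is_derive_eq (is_deriveM De
      (is_deriveB (is_deriveM Dc Du) (is_deriveM Ds Dv)))).
    by rewrite /GRing.scale /= !fctE /= -gr -gi; ring.
  rewrite (_ : FI = (@expR R \o a)
      * ((@cos R \o b) * v + (@sin R \o b) * u)); last first.
    by apply/funext => s; exact: FIm.
  apply: (is_derive_eq (is_deriveM De
    (is_deriveD (is_deriveM Dc Dv) (is_deriveM Ds Du)))).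
  by rewrite /GRing.scale /= !fctE /= -gr -gi; ring.
apply/eqP; rewrite eq_complex; apply/andP; split; apply/eqP.
  exact: (eq_from_derive0 (fun y yz => (D y yz).1) xz).
exact: (eq_from_derive0 (fun y yz => (D y yz).2) xz).
Qed.

End MiwaSum.
End Evolution.

Section EvolutionShift.
Variable R : realType.
Local Notation C := R[i].
Local Notation plane := (R * R)%type.
Implicit Types (t : times R) (z : C) (q : plane).

Lemma norm_normc z : `|z| = (normc z)%:C.
Proof. by case: z => a b; rewrite normc_def. Qed.

Lemma normc_neq0 z : 0 < normc z -> z != 0.
Proof. by move=> z0; apply: contraTneq z0 => ->; rewrite normc0 ltxx. Qed.

Lemma finite_times_cvg t : finite_times t -> exists N, forall x : R,
  tseries_cvg t.1 x (tsum t.1 x N) /\ tseries_cvg t.2 x (tsum t.2 x N).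
Proof.
by move=> [N tN]; exists N => x; split; apply: tseries_cvg_finite => j Nj;
  have [] := tN j Nj.
Qed.

Lemma cexp_miwa_sumN z (x : R) : `|x| < normc z ->
  cexp (- miwa_sum z x) = 1 - x%:C / z.
Proof.
move=> xz; have z0 : 0 < normc z by exact: le_lt_trans xz.
rewrite cexpN; apply: (mulfI (cexp_unit (miwa_sum z x))).
by rewrite (cexp_miwa_sum z0 xz) mulfV// cexp_unit.
Qed.

Lemma tseries_addmiwa (a : nat -> C) (l : C) z (x : R) :
  tseries_cvg a x l -> `|x| < normc z ->
  tseries (fun j => a j + miwa z j) x%:C = tseries a x%:C + miwa_sum z x.
Proof.
move=> al xz; have z0 : 0 < normc z by exact: le_lt_trans xz.
have ml := miwa_sum_cvg z0 xz.
rewrite (tseries_cvgE al).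
exact: (tseries_cvgE (tseries_cvgD al ml)).
Qed.

Lemma tseries_submiwa (a : nat -> C) (l : C) z (x : R) :
  tseries_cvg a x l -> `|x| < normc z ->
  tseries (fun j => a j - miwa z j) x%:C = tseries a x%:C - miwa_sum z x.
Proof.
move=> al xz; have z0 : 0 < normc z by exact: le_lt_trans xz.
have ml := miwa_sum_cvg z0 xz.
rewrite (tseries_cvgE al).
exact: (tseries_cvgE (tseries_cvgD al (tseries_cvgN ml))).
Qed.

Lemma evolution_submiwa1 t z q : finite_times t -> `|q.1| < normc z ->
  evolution (submiwa1 t z) q = evolution t q * (1 - q.1%:C / z).
Proof.
move=> /finite_times_cvg[N tN] qz.
rewrite /evolution /submiwa1 /= (tseries_submiwa (tN q.1).1 qz).
by rewrite -cexp_miwa_sumN// -cexpD addrAC.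
Qed.

Lemma evolution_addmiwa1 t z q : finite_times t -> `|q.1| < normc z ->
  evolution t q = evolution (addmiwa1 t z) q * (1 - q.1%:C / z).
Proof.
move=> /finite_times_cvg[N tN] qz.
rewrite /evolution /addmiwa1 /= (tseries_addmiwa (tN q.1).1 qz).
by rewrite -cexp_miwa_sumN// -cexpD addrAC addrK.
Qed.

Lemma evolution_submiwa2 t z q : finite_times t -> `|q.2| < normc z ->
  evolution t q = evolution (submiwa2 t z) q * (1 - q.2%:C / z).
Proof.
move=> /finite_times_cvg[N tN] qz.
rewrite /evolution /submiwa2 /= (tseries_submiwa (tN q.2).2 qz).
by rewrite -cexp_miwa_sumN// -cexpD opprD opprK addrA addrK.
Qed.

Lemma evolution_addmiwa2 t z q : finite_times t -> `|q.2| < normc z ->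
  evolution (addmiwa2 t z) q = evolution t q * (1 - q.2%:C / z).
Proof.
move=> /finite_times_cvg[N tN] qz.
rewrite /evolution /addmiwa2 /= (tseries_addmiwa (tN q.2).2 qz).
by rewrite -cexp_miwa_sumN// -cexpD opprD addrA.
Qed.

Lemma smooth_sum (I : Type) (r : seq I) (f : I -> plane -> C) :
  (forall i, smooth (f i)) -> smooth (fun q => \sum_(i <- r) f i q).
Proof.
move=> Sf; elim: r => [|i r IHr].
  by under eq_fun do rewrite big_nil; exact: smooth_cst.
by under eq_fun do rewrite big_cons; exact: smoothD.
Qed.

Lemma smooth_cexp (f : plane -> C) : smooth f -> smooth (fun q => cexp (f q)).
Proof.
move=> Sf n; have [Rf If] := Sf n.
have Ef := Cn_comp (smooth1_expR R) Rf.
split; rewrite /cexp /=.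
  under eq_fun do rewrite mul0r subr0.
  by apply: CnM => //; exact: (Cn_comp (smooth1_cos R) If).
under eq_fun do rewrite mul0r addr0.
by apply: CnM => //; exact: (Cn_comp (smooth1_sin R) If).
Qed.

Lemma smooth_evolution t : finite_times t -> smooth (evolution t).
Proof.
move=> /finite_times_cvg[N tN].
rewrite (_ : evolution t
    = fun q => cexp (tsum t.1 q.1 N + (-1) * tsum t.2 q.2 N)); last first.
  apply/funext => q; rewrite /evolution mulN1r.
  by rewrite (tseries_cvgE (tN q.1).1) (tseries_cvgE (tN q.2).2).
apply: smooth_cexp; apply: smoothD; last first.
  apply: smoothM; first exact: smooth_cst.
  apply: smooth_sum => j; apply: smoothM; first exact: smooth_cst.
  by apply: smoothX; apply: smooth_real => n; exact: Cn_snd.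
apply: smooth_sum => j; apply: smoothM; first exact: smooth_cst.
by apply: smoothX; apply: smooth_real => n; exact: Cn_fst.
Qed.

Lemma near_norm_lt (X : plane -> R) q (rho : R) : continuous X ->
  `|X q| < rho -> \forall q' \near q, `|X q'| < rho.
Proof.
move=> cX Xq.
have cN : {for q, continuous (fun q' => `|X q'|)}.
  apply: continuous_comp; first exact: cX.
  exact: norm_continuous.
exact: (cN _ (lt_nbhsl Xq)).
Qed.

(** When z is real, 1 / (1 - X / z) has a pole in the plane.  Written as
    z (conj z - X) / |z - X|^2, it becomes smooth everywhere, and unchanged near
    K, if one minus a plateau in X^2 that drops to 0 before X^2 reaches |z|^2 is
    added to the denominator. *)
Lemma smooth_near_miwa_factor (K : set plane) (X : plane -> R) (r s : R) z :
  (forall n, Cn n X) -> (forall q, K q -> `|q.1| <= s /\ `|q.2| <= s) ->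
  (forall q, K q -> `|X q| <= r) -> 0 <= r -> r < normc z ->
  smooth_near K (fun q => (1 - (X q)%:C / z)^-1).
Proof.
move=> CX Ks Kr r0 rz.
have z0 : z != 0 by apply: normc_neq0; exact: le_lt_trans rz.
pose zr := complex.Re z; pose zi := complex.Im z.
have zE : normc z ^+ 2 = zr ^+ 2 + zi ^+ 2.
  rewrite /zr /zi; case: (z) => a b /=.
  by rewrite sqr_sqrtr// addr_ge0 ?sqr_ge0.
pose B := normc z ^+ 2; pose A := (r ^+ 2 + B) / 2.
have rB : r ^+ 2 < B by rewrite ltrXn2r.
have rA : r ^+ 2 < A by rewrite /A; lra.
have AB : A < B by rewrite /A; lra.
pose g q := (zr - X q) ^+ 2 + zi ^+ 2 + (1 - plateau A B (X q ^+ 2)).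
have g0 q : g q != 0.
  apply: lt0r_neq0; rewrite /g.
  have := plateau_le1 (X q ^+ 2) AB.
  have [BX|XB] := leP B (X q ^+ 2).
    by rewrite plateau_out// => _; have := sqr_ge0 (zr - X q); have := sqr_ge0 zi; lra.
  move=> p1; have := sqr_ge0 (zr - X q); have := sqr_ge0 zi => zi0 zx0.
  suff : 0 < (zr - X q) ^+ 2 + zi ^+ 2 by lra.
  rewrite lt_neqAle addr_ge0// andbT eq_sym; apply/negP.
  rewrite paddr_eq0// !sqrf_eq0 subr_eq0 => /andP[/eqP E1 /eqP E2].
  by move: XB; rewrite /B zE E1 E2 expr0n addr0 ltxx.
pose f q := z * ((zr - X q)%:C + - 'i%C * zi%:C) * ((g q)^-1)%:C.
apply: (@smooth_near_eq _ _ f); last first.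
  apply: (smooth_smooth_near Ks).
  apply: smoothM; last first.
    apply: smooth_real => n; apply: CnV => //.
    apply: CnD.
      apply: CnD; last exact: Cn_cst.
      by apply: CnX; apply: CnB; [exact: Cn_cst|exact: CX].
    apply: CnB; first exact: Cn_cst.
    by apply: Cn_plateau; apply: CnX; exact: CX.
  apply: smoothM; first exact: smooth_cst.
  apply: smoothD; last exact: smooth_cst.
  by apply: smooth_real => n; apply: CnB; [exact: Cn_cst|exact: CX].
move=> q Kq.
have A0 : 0 <= A by apply: le_trans (ltW rA); exact: sqr_ge0.
have sA : r < Num.sqrt A.
  by rewrite -ltr_sqr ?nnegrE ?sqrtr_ge0// sqr_sqrtr.
have cX : continuous X by exact: Cn_cont (CX 0%N).
have := near_norm_lt cX (le_lt_trans (Kr _ Kq) sA).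
apply: filterS => q' q'A.
have XA : X q' ^+ 2 < A.
  rewrite -[X q' ^+ 2]real_normK ?num_real// -[ltRHS]sqr_sqrtr//.
  by rewrite ltr_sqr ?nnegrE ?sqrtr_ge0.
have gE : g q' = (zr - X q') ^+ 2 + zi ^+ 2.
  by rewrite /g plateau_in ?subrr ?addr0// ltW.
have gC : (z - (X q')%:C) * ((zr - X q')%:C + - 'i%C * zi%:C) = (g q')%:C.
  rewrite gE /zr /zi; case: (z) => a b.
  by apply/eqP; rewrite eq_complex /=; apply/andP; split; apply/eqP; ring.
have z1 : z - (X q')%:C != 0.
  apply: contraNneq (g0 q') => E; move: gC; rewrite E mul0r => /esym/eqP.
  by rewrite fmorph_eq0.
have -> : (1 - (X q')%:C / z)^-1 = z * (z - (X q')%:C)^-1.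
  by rewrite -[1](mulfV z0) -mulrBl invfM invrK mulrC.
rewrite /f -mulrA; congr (_ * _).
apply: (mulfI z1); rewrite mulfV// mulrA gC -rmorphM /=.
by rewrite mulfV.
Qed.

End EvolutionShift.

(** * Moments of the evolved kernels *)

Section Moments.
Variables (R : realType) (p : nat) (u : mkernel R p).
Local Notation C := R[i].
Local Notation plane := (R * R)%type.
Local Notation M := 'M[C]_p.
Hypothesis u_distr : forall k l, Defs.distribution (u k l).
Hypothesis hx : has_ubound [set `|x| | x in suppx u].
Hypothesis hy : has_ubound [set `|y| | y in suppy u].

Definition smooth_near_supp (f : plane -> C) : Prop :=
  forall k l, smooth_near (dsupp (u k l)) f.

Lemma dsupp_rx k l q : dsupp (u k l) q -> `|q.1| <= rx u.
Proof.
move=> uq; apply: ub_le_sup => //; exists q.1 => //.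
by exists q => //; exists k, l.
Qed.

Lemma dsupp_ry k l q : dsupp (u k l) q -> `|q.2| <= ry u.
Proof.
move=> uq; apply: ub_le_sup => //; exists q.2 => //.
by exists q => //; exists k, l.
Qed.

Lemma sup_norm_ge0 (A : set R) : has_ubound [set `|x| | x in A] ->
  0 <= sup [set `|x| | x in A].
Proof.
move=> hA; have [->|/set0P[x Ax]] := eqVneq A set0.
  by rewrite image_set0 sup0.
by apply: le_trans (normr_ge0 x) _; apply: ub_le_sup => //; exists x.
Qed.

Lemma dsupp_bounded k l q : dsupp (u k l) q ->
  `|q.1| <= Num.max (rx u) (ry u) /\ `|q.2| <= Num.max (rx u) (ry u).
Proof.
move=> uq; rewrite !le_max (dsupp_rx uq) (dsupp_ry uq) orbT; by split.
Qed.

Lemma smooth_smooth_near_supp f : smooth f -> smooth_near_supp f.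
Proof. by move=> Sf k l; exact: smooth_smooth_near (@dsupp_bounded k l) Sf. Qed.

Lemma smooth_near_suppM f g : smooth_near_supp f -> smooth_near_supp g ->
  smooth_near_supp (fun q => f q * g q).
Proof. by move=> sf sg k l; exact: smooth_nearM. Qed.

(** The pairing of the evolved kernel with a scalar function; every sesquilinear
    form below is a combination of such matrices. *)
Definition moment (s : times R) (h : plane -> C) : M :=
  \matrix_(i, j) pairing (u i j) (fun q => evolution s q * h q).

Lemma form_moment (s : times R) (m n : nat) (S W : nat -> M)
    (f g : nat -> R -> C) :
  (forall k l, smooth_near_supp
     (fun q => evolution s q * (f k q.1 * g l q.2))) ->
  Defs.form (evolved u s) (fun x => \sum_(k < m) S k *m (f k x)%:M)
    (fun y => \sum_(l < n) W l *m (g l y)%:M)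
  = \sum_(k < m) \sum_(l < n)
      S k *m moment s (fun q => f k q.1 * g l q.2) *m (W l)^T.
Proof.
move=> sfg; apply/matrixP => i j; rewrite mxE summxE.
have sumE (N : nat) (A : nat -> M) (h : nat -> R -> C) x a b :
    (\sum_(k < N) A k *m (h k x)%:M) a b = \sum_(k < N) A k a b * h k x.
  rewrite summxE; apply: eq_bigr => k _.
  by rewrite mul_mx_scalar mxE mulrC.
transitivity (\sum_a \sum_b \sum_(kl : 'I_m * 'I_n)
    S kl.1 i a * W kl.2 j b
    * moment s (fun q => f kl.1 q.1 * g kl.2 q.2) a b).
  apply: eq_bigr => a _; apply: eq_bigr => b _; rewrite /evolved.
  under [RHS]eq_bigr do rewrite mxE.
  rewrite -(pairing_sum (index_enum _)
    (fun kl : 'I_m * 'I_n => S kl.1 i a * W kl.2 j b)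
    (f := fun kl q => evolution s q * (f kl.1 q.1 * g kl.2 q.2)))//;
    last by move=> kl; exact: sfg.
  congr (pairing (u a b)); apply/funext => q.
  rewrite !sumE big_distrlr /= pair_bigA /= mulr_sumr.
  by apply: eq_bigr => -[k l] _ /=; ring.
under eq_bigr => a _ do rewrite exchange_big /=.
rewrite exchange_big /= -(pair_bigA _ (fun (k : 'I_m) (l : 'I_n) => \sum_a \sum_b
   S k i a * W l j b * moment s (fun q => f k q.1 * g l q.2) a b)) /=.
apply: eq_bigr => k _; rewrite summxE; apply: eq_bigr => l _.
rewrite mxE exchange_big /=; apply: eq_bigr => b _.
rewrite !mxE mulr_suml; apply: eq_bigr => a _.
by ring.
Qed.

Lemma smooth_monomial k l :
  smooth (fun q : plane => q.1%:C ^+ k * q.2%:C ^+ l).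
Proof.
apply: smoothM; apply: smoothX; apply: smooth_real => n.
  exact: Cn_fst.
exact: Cn_snd.
Qed.

Lemma gram_moment (s : times R) k l : smooth_near_supp (evolution s) ->
  gram u s k l = moment s (fun q => q.1%:C ^+ k * q.2%:C ^+ l).
Proof.
move=> ss.
have := @form_moment s 1 1 (fun=> 1%:M) (fun=> 1%:M)
  (fun _ x => x%:C ^+ k) (fun _ y => y%:C ^+ l).
rewrite !big_ord1 trmx1 mulmx1 mul1mx => <-.
  by congr Defs.form; apply/funext => x; rewrite big_ord1 mul1mx.
move=> _ _; apply: smooth_near_suppM => //.
exact/smooth_smooth_near_supp/smooth_monomial.
Qed.

Lemma moment_eq (s s' : times R) (h h' : plane -> C) (a : C) :
  smooth_near_supp (fun q => evolution s' q * h' q) ->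
  (forall k l, agrees_near (dsupp (u k l)) (fun q => evolution s q * h q)
    (fun q => a * (evolution s' q * h' q))) ->
  moment s h = a *: moment s' h'.
Proof.
move=> sh E; apply/matrixP => i j; rewrite !mxE.
rewrite (pairing_eq (E i j)) -[RHS]addr0 -(pairing0 (u_distr i j)).
rewrite -pairing_lin//; last exact: smooth_near0.
by under [in RHS]eq_fun do rewrite addr0.
Qed.

Lemma moment_sub (s s' : times R) (h h1 h2 : plane -> C) (a : C) :
  smooth_near_supp (fun q => evolution s' q * h1 q) ->
  smooth_near_supp (fun q => evolution s' q * h2 q) ->
  (forall k l, agrees_near (dsupp (u k l)) (fun q => evolution s q * h q)
    (fun q => evolution s' q * h1 q - a * (evolution s' q * h2 q))) ->
  moment s h = moment s' h1 - a *: moment s' h2.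
Proof.
move=> sh1 sh2 E; apply/matrixP => i j; rewrite !mxE.
rewrite (pairing_eq (E i j)) addrC -mulNr -pairing_lin//.
by congr pairing; apply/funext => q; rewrite mulNr addrC.
Qed.

Lemma resolvent_cancel (z x e h : C) : z != 0 -> 1 - x / z != 0 ->
  e * (1 - x / z) * ((z - x)^-1 * h) = z^-1 * (e * h).
Proof.
move=> z0 w0; have -> : z - x = z * (1 - x / z).
  by rewrite mulrBr mulr1 mulrCA mulfV// mulr1.
by move: w0; set P := 1 - _ => P0; field; rewrite z0 P0.
Qed.

Lemma resolventE (z x : C) : z != 0 -> (z - x)^-1 = z^-1 * (1 - x / z)^-1.
Proof. by move=> z0; rewrite -invfM mulrBr mulr1 mulrCA mulfV// mulr1. Qed.

Lemma smooth_near_resolvent (X : plane -> R) (r : R) z :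
  (forall n, Cn n X) -> (forall k l q, dsupp (u k l) q -> `|X q| <= r) ->
  0 <= r -> r < normc z ->
  smooth_near_supp (fun q => (1 - (X q)%:C / z)^-1).
Proof.
move=> CX Xr r0 rz k l.
exact: (smooth_near_miwa_factor CX (@dsupp_bounded k l) (Xr k l) r0 rz).
Qed.

Lemma agrees_near_coord (X : plane -> R) (r rho : R) (f g : plane -> C) :
  continuous X -> (forall k l q, dsupp (u k l) q -> `|X q| <= r) ->
  r < rho -> (forall q, `|X q| < rho -> f q = g q) ->
  forall k l, agrees_near (dsupp (u k l)) f g.
Proof.
move=> cX Xr rrho fg k l q uq.
by apply: filterS (near_norm_lt cX (le_lt_trans (Xr k l q uq) rrho)) => q' /fg.
Qed.

(** X is one of the two coordinates and r bounds it on the support.  The times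
    s' and s differ by a Miwa shift in the corresponding variable, so that their
    evolution factors differ by 1 - X / z where the Miwa series converges. *)
Section Shift.
Variables (X : plane -> R) (r : R) (z : C) (s s' : times R).
Hypothesis CX : forall n, Cn n X.
Hypothesis Xr : forall k l q, dsupp (u k l) q -> `|X q| <= r.
Hypothesis r0 : 0 <= r.
Hypothesis rz : r < normc z.
Hypothesis E : forall q, `|X q| < normc z ->
  evolution s' q = evolution s q * (1 - (X q)%:C / z).

Let cX : continuous X := Cn_cont (CX 0).
Let z0 : z != 0 := normc_neq0 (le_lt_trans r0 rz).

Let factor_neq0 q : `|X q| < normc z -> 1 - (X q)%:C / z != 0.
Proof.
by move=> qz; rewrite mulrC; apply: miwa_ratio_neq1 => //; exact: le_lt_trans qz.
Qed.

Let smooth_factor : smooth (fun q => 1 - (X q)%:C / z).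
Proof.
under eq_fun do rewrite -mulNr -[- _]mulN1r.
apply: smoothD; first exact: smooth_cst.
apply: smoothM; last exact: smooth_cst.
by apply: smoothM; [exact: smooth_cst|exact: smooth_real].
Qed.

Lemma smooth_near_shift :
  smooth_near_supp (evolution s) -> smooth_near_supp (evolution s').
Proof.
move=> ss k l; apply: (@smooth_near_eq _ _
  (fun q => evolution s q * (1 - (X q)%:C / z))).
  by apply: (agrees_near_coord cX Xr rz) => q /E ->.
by apply: smooth_near_suppM => //; exact: smooth_smooth_near_supp.
Qed.

Lemma smooth_near_unshift :
  smooth_near_supp (evolution s') -> smooth_near_supp (evolution s).
Proof.
move=> ss' k l; apply: (@smooth_near_eq _ _
  (fun q => evolution s' q * (1 - (X q)%:C / z)^-1)).
  apply: (agrees_near_coord cX Xr rz) => q qz.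
  by rewrite E// mulfK ?factor_neq0.
by apply: smooth_near_suppM => //; exact: (smooth_near_resolvent CX Xr r0 rz).
Qed.

Hypothesis ss : smooth_near_supp (evolution s).

Lemma moment_shift h : smooth h ->
  moment s' h = moment s h - z^-1 *: moment s (fun q => (X q)%:C * h q).
Proof.
move=> Sh; apply: moment_sub.
- exact/(smooth_near_suppM ss)/smooth_smooth_near_supp.
- apply/(smooth_near_suppM ss)/smooth_smooth_near_supp/smoothM => //.
  exact: smooth_real.
by apply: (agrees_near_coord cX Xr rz) => q /E ->; ring.
Qed.

Lemma moment_resolvent h : smooth h ->
  moment s' (fun q => (z - (X q)%:C)^-1 * h q) = z^-1 *: moment s h.
Proof.
move=> Sh; apply: moment_eq.
  exact/(smooth_near_suppM ss)/smooth_smooth_near_supp.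
apply: (agrees_near_coord cX Xr rz) => q qz.
by rewrite E// resolvent_cancel ?factor_neq0.
Qed.

Lemma smooth_near_moment_resolvent h : smooth h ->
  smooth_near_supp (fun q => evolution s' q * ((z - (X q)%:C)^-1 * h q)).
Proof.
move=> Sh; apply: smooth_near_suppM; first exact: smooth_near_shift.
apply: smooth_near_suppM; last exact: smooth_smooth_near_supp.
under eq_fun do rewrite resolventE//.
apply: smooth_near_suppM; last exact: (smooth_near_resolvent CX Xr r0 rz).
exact/smooth_smooth_near_supp/smooth_cst.
Qed.

End Shift.

Section ShiftX.
Variables (z : C) (s s' : times R).
Hypothesis rz : rx u < normc z.
Hypothesis ss : smooth_near_supp (evolution s).
Hypothesis E : forall q, `|q.1| < normc z ->
  evolution s' q = evolution s q * (1 - q.1%:C / z).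

Let r0 := sup_norm_ge0 hx.
Let cfst n : Cn n (fun q : plane => q.1) := @Cn_fst R n.
Let ss' := smooth_near_shift cfst dsupp_rx rz E ss.

Lemma gram_shiftx : shifted z (gram u s) (gram u s').
Proof.
move=> k l; rewrite !gram_moment//.
rewrite (moment_shift cfst dsupp_rx rz E ss (smooth_monomial k l)).
by congr (_ - _ *: moment _ _); apply/funext => q; rewrite exprS mulrA.
Qed.

(** The resolvent 1/(z - x) cancels the factor 1 - x/z up to 1/z, so a second
    kind function is a pairing with the constant 1 at the shifted time. *)
Lemma C2_unshift n : (C2 u s' n z)^T
  = z^-1 *: \sum_(l < n.+1) gram u s 0 l *m (gbS2 u s' n l)^T.
Proof.
rewrite trmxK.
have := @form_moment s' 1 n.+1 (fun=> 1%:M) (gbS2 u s' n)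
  (fun _ x => (z - x%:C)^-1) (fun l y => y%:C ^+ l).
have Sy l : smooth (fun q : plane => q.2%:C ^+ l).
  by apply: smoothX; apply: smooth_real => m; exact: Cn_snd.
move=> H; transitivity (\sum_(k < 1) \sum_(l < n.+1) 1%:M
    *m moment s' (fun q => (z - q.1%:C)^-1 * q.2%:C ^+ l) *m (gbS2 u s' n l)^T).
  rewrite -H; last first.
    by move=> _ l; exact: (smooth_near_moment_resolvent cfst dsupp_rx r0 rz E).
  by congr Defs.form; apply/funext => x; rewrite big_ord1 mul1mx.
rewrite big_ord1 scaler_sumr; apply: eq_bigr => l _.
rewrite mul1mx (moment_resolvent cfst dsupp_rx r0 rz E ss (Sy _)) -scalemxAl.
congr (_ *: (_ *m _)); rewrite gram_moment//.
by under [in RHS]eq_fun do rewrite expr0 mul1r.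
Qed.

End ShiftX.

Section ShiftY.
Variables (z : C) (s s' : times R).
Hypothesis rz : ry u < normc z.
Hypothesis ss : smooth_near_supp (evolution s).
Hypothesis E : forall q, `|q.2| < normc z ->
  evolution s' q = evolution s q * (1 - q.2%:C / z).

Let r0 := sup_norm_ge0 hy.
Let csnd n : Cn n (fun q : plane => q.2) := @Cn_snd R n.
Let ss' := smooth_near_shift csnd dsupp_ry rz E ss.

Lemma gram_shifty : shifted z (btr (gram u s)) (btr (gram u s')).
Proof.
move=> k l; rewrite /btr !gram_moment//.
rewrite (moment_shift csnd dsupp_ry rz E ss (smooth_monomial l k)).
rewrite linearB linearZ /=.
congr (_ - _ *: (moment _ _)^T); apply/funext => q.
by rewrite exprS mulrCA.
Qed.

Lemma C1_unshift n : C1 u s' n z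
  = z^-1 *: \sum_(k < n.+1) gbS1 u s' n k *m gram u s k 0.
Proof.
have := @form_moment s' n.+1 1 (gbS1 u s' n) (fun=> 1%:M)
  (fun k x => x%:C ^+ k) (fun _ y => (z - y%:C)^-1).
have Sx k : smooth (fun q : plane => q.1%:C ^+ k).
  by apply: smoothX; apply: smooth_real => m; exact: Cn_fst.
move=> H; transitivity (\sum_(k < n.+1) \sum_(l < 1) gbS1 u s' n k
    *m moment s' (fun q => q.1%:C ^+ k * (z - q.2%:C)^-1) *m (1%:M)^T).
  rewrite -H; last first.
    move=> k _; under eq_fun do rewrite [X in _ * X]mulrC.
    exact: (smooth_near_moment_resolvent csnd dsupp_ry r0 rz E).
  by congr Defs.form; apply/funext => y; rewrite big_ord1 mul1mx.
rewrite scaler_sumr; apply: eq_bigr => k _; rewrite big_ord1 trmx1 mulmx1.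
under eq_fun do rewrite mulrC.
rewrite (moment_resolvent csnd dsupp_ry r0 rz E ss (Sx k)) -scalemxAr.
congr (_ *: (_ *m _)); rewrite gram_moment//.
by under [in RHS]eq_fun do rewrite expr0 mulr1.
Qed.

End ShiftY.
End Moments.

(** * Biorthogonal polynomials and second kind functions as tau-ratios *)

Section TauRatios.
Variables (R : realType) (p : nat) (u : mkernel R p).

Lemma tau1E m (t s : times R) :
  tau1 u m t s = ratio_product (fun k => gbH u t k *m invmx (gbH u s k)) m.
Proof. by elim: m => //= m ->. Qed.

Lemma tau2E m (t s : times R) :
  tau2 u m t s = ratio_product (fun k => invmx (gbH u t k) *m gbH u s k) m.
Proof. by elim: m => //= m ->. Qed.

Lemma gb_rows (s : times R) : quasidefinite (gram u s) ->
  row_factor (gram u s) (gbS1 u s) (gbH u s) /\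
  row_factor (btr (gram u s)) (gbS2 u s) (fun n => (gbH u s n)^T).
Proof. by move=> /factorsP; exact: gauss_borel_rows. Qed.

Lemma btrK (G : blockmx R p) : btr (btr G) = G.
Proof. by apply/funext => k; apply/funext => l; rewrite /btr trmxK. Qed.

End TauRatios.

Unset Implicit Arguments.
Set Strict Implicit.
Set Printing Implicit Defensive.

Theorem theorem11 (R : realType) (p : nat) (hp : (0 < p)%N)
    (u : mkernel R p)
    (hu : forall k l, fast_decreasing (u k l))
    (hx : has_ubound [set `|x| | x in suppx u])
    (hy : has_ubound [set `|y| | y in suppy u])
    (t : times R) (ht : finite_times t) (hqt : quasidefinite (gram u t))
    (n : nat) (z : R[i]) :
  ((rx u)%:C < `|z| ->
     (quasidefinite (gram u (submiwa1 t z)) ->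
        P1 u t n z = z ^+ n *: tau1 u n (submiwa1 t z) t) /\
     (quasidefinite (gram u (addmiwa1 t z)) ->
        (C2 u t n z)^T *m invmx (gbH u t n)
          = z ^- n.+1 *: invmx (tau1 u n.+1 t (addmiwa1 t z)))) /\
  ((ry u)%:C < `|z| ->
     (quasidefinite (gram u (submiwa2 t z)) ->
        invmx (gbH u t n) *m C1 u t n z
          = z ^- n.+1 *: tau2 u n.+1 t (submiwa2 t z)) /\
     (quasidefinite (gram u (addmiwa2 t z)) ->
        (P2 u t n z)^T = z ^+ n *: invmx (tau2 u n (addmiwa2 t z) t))).
Proof.
have du k l : Defs.distribution (u k l) by case: (hu k l).
have st : smooth_near_supp u (evolution t).
  exact: (smooth_smooth_near_supp hx hy (smooth_evolution ht)).
have [S1t S2t] := gb_rows hqt.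
have Hu s : quasidefinite (gram u s) -> forall k, gbH u s k \in unitmx.
  by move=> qs k; exact: row_factor_unit (gb_rows qs).1.
have Ht := Hu t hqt.
have S1tt : row_factor (btr (btr (gram u t))) (gbS1 u t)
    (fun k => ((gbH u t k)^T)^T).
  by rewrite btrK; under [fun _ => _]eq_fun do rewrite trmxK.
split=> [|]; rewrite norm_normc ltcR => rz.
  have z0 : z != 0.
    by apply: normc_neq0; apply: le_lt_trans rz; exact: sup_norm_ge0 hx.
  split=> qs; have [S1s S2s] := gb_rows qs.
    have E q : `|q.1| < normc z -> evolution (submiwa1 t z) q
        = evolution t q * (1 - q.1%:C / z) by exact: evolution_submiwa1.
    have GG := gram_shiftx du hx hy rz st E.
    by rewrite tau1E; exact: (rowpoly_shift z0 hqt S1t S1s GG).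
  (* here u^t is the kernel multiplied by 1 - x/z *)
  have E q : `|q.1| < normc z -> evolution t q
      = evolution (addmiwa1 t z) q * (1 - q.1%:C / z).
    exact: evolution_addmiwa1.
  have ss := smooth_near_unshift hx hy (@Cn_fst R) (dsupp_rx hx)
    (sup_norm_ge0 hx) rz E st.
  have GG := gram_shiftx du hx hy rz ss E.
  have := dual_moment_shift z0 qs S1s S1t GG n S2t.
  rewrite (C2_unshift du hx hy rz ss E) -tau1E.
  set V := \sum_(l < _) _ => HV.
  have Hs := Hu _ qs.
  have ut : tau1 u n t (addmiwa1 t z) \in unitmx.
    rewrite tau1E; apply: ratio_product_unit => k.
    by rewrite unitmx_mul Ht unitmx_inv Hs.
  have -> : V = z ^- n *: (invmx (tau1 u n t (addmiwa1 t z))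
      *m gbH u (addmiwa1 t z) n).
    rewrite HV -scalemxAr scalerA mulVf ?expf_neq0// scale1r.
    by rewrite mulmxA mulVmx// mul1mx.
  rewrite /= invmx_mul ?unitmx_mul ?Ht ?unitmx_inv ?Hs//.
  have -> : invmx (gbH u t n *m invmx (gbH u (addmiwa1 t z) n))
      = gbH u (addmiwa1 t z) n *m invmx (gbH u t n).
    by rewrite invmx_mul ?unitmx_inv// invmxK.
  by rewrite scalerA exprS invfM -scalemxAl mulmxA.
have z0 : z != 0.
  by apply: normc_neq0; apply: le_lt_trans rz; exact: sup_norm_ge0 hy.
have qtt := quasidefinite_tr hqt.
split=> qs; have [S1s S2s] := gb_rows qs; have Hs := Hu _ qs.
  (* t_2 enters the kernel through exp(- t_2(y)), so that subtracting a Miwa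
     shift divides the kernel by 1 - y/z *)
  have E q : `|q.2| < normc z -> evolution t q
      = evolution (submiwa2 t z) q * (1 - q.2%:C / z).
    exact: evolution_submiwa2.
  have ss := smooth_near_unshift hx hy (@Cn_snd R) (dsupp_ry hy)
    (sup_norm_ge0 hy) rz E st.
  have GG := gram_shifty du hx hy rz ss E.
  have := dual_moment_shift z0 (quasidefinite_tr qs) S2s S2t GG n S1tt.
  move=> /(congr1 trmx); rewrite linearZ /= trmx_mul trmxK.
  rewrite ratio_product_tr// -tau2E (C1_unshift du hx hy rz ss E).
  have -> : (\sum_(l < n.+1) btr (gram u (submiwa2 t z)) 0%N l
        *m (gbS1 u t n l)^T)^T
      = \sum_(k < n.+1) gbS1 u t n k *m gram u (submiwa2 t z) k 0%N.
    by rewrite raddf_sum /=; apply: eq_bigr => k _; rewrite trmx_mul /btr !trmxK.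
  set V := \sum_(l < _) _ => HV.
  have ut : tau2 u n t (submiwa2 t z) \in unitmx.
    rewrite tau2E; apply: ratio_product_unit => k.
    by rewrite unitmx_mul unitmx_inv; apply/andP; split; [exact: Ht|exact: Hs].
  have -> : V = z ^- n *: (gbH u (submiwa2 t z) n
      *m tau2 u n t (submiwa2 t z)).
    rewrite HV -scalemxAl scalerA mulVf ?expf_neq0// scale1r.
    by rewrite -mulmxA mulVmx// mulmx1.
  by rewrite /= scalerA exprS invfM -scalemxAr mulmxA.
have E q : `|q.2| < normc z -> evolution (addmiwa2 t z) q
    = evolution t q * (1 - q.2%:C / z) by exact: evolution_addmiwa2.
have GG := gram_shifty du hx hy rz st E.
have := rowpoly_shift z0 qtt S2t S2s GG n.
rewrite -/(P2 u t n z) => ->.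
by rewrite linearZ /= ratio_product_tr// -tau2E.
Qed.
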